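(* Let $\mathcal C$ be a countable $d$-dimensional simplicial complex which contains a contractible spanning subcomplex $\mathcal D$. Then the topological space $|\mathcal C|$ is homotopy equivalent to a bouquet of $r$ $d$-spheres, for some $r$ (where $r$ can be $0$, meaning that $|\mathcal C|$ is contractible, or $\infty$). If, in addition, $\mathcal C$ is $n$-regular and $\mathcal D_i$ ($i=1,2,\ldots$) are finite subcomplexes of $\mathcal D$ such that $\mathcal D=\liminf\mathcal D_i$, then $$r=\lim_{i\to\infty}\left(\frac1{d+1}\Bigl(n\,\beta_{d-1}(\mathcal D_i)-\deg_{\langle\mathcal D-\mathcal D_i\rangle}\bigl(F^{d-1}(\partial\mathcal D_i)\bigr)\Bigr)-\beta_d(\mathcal D_i)\right).$$
   Context: $|\mathcal C|$ denotes the topological space (geometric realization) of a simplicial complex $\mathcal C$; topological properties attributed to a complex refer to this space. A subcomplex $\mathcal D$ of a $d$-dimensional simplicial complex $\mathcal C$ is a spanning subcomplex if (i) $\mathcal D$ contains the $(d-1)$-skeleton $\mathcal C^{(d-1)}$ of $\mathcal C$, and (ii) every principal simplex of $\mathcal D$ (a simplex that is not a face of a simplex of $\mathcal D$ of higher dimension) is also principal in $\mathcal C$. A contractible spanning subcomplex is a spanning subcomplex whose topological space is contractible. $F^k(\mathcal C)$ is the set of $k$-simplices of $\mathcal C$ and $\beta_k(\mathcal C)$ its cardinality. The degree of a $k$-simplex $\sigma^k$ in a complex is the number of $(k+1)$-simplices of that complex that contain $\sigma^k$; the complex $\mathcal C$ of dimension $d$ is $n$-regular ($n$ a non-negative integer)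 if every $(d-1)$-simplex of $\mathcal C$ has degree $n$ in $\mathcal C$. For a set $X$ of simplices, $\deg_{\mathcal E}(X)$ is the sum of the degrees of the members of $X$ computed in the subcomplex $\mathcal E$ (i.e. counting only the simplices of $\mathcal E$ containing them). $\mathcal D-\mathcal D_i$ is the set of simplices of $\mathcal D$ not in $\mathcal D_i$, $\langle X\rangle$ is the subcomplex generated by a set $X$ of simplices (the smallest subcomplex containing $X$), and the boundary of $\mathcal D_i$ in $\mathcal D$ is $\partial\mathcal D_i=\mathcal D_i\cap\langle\mathcal D-\mathcal D_i\rangle$. $\mathcal D=\liminf\mathcal D_i$ means $F^k(\mathcal D)=\bigcup_{i\ge1}\bigcap_{j\ge i}F^k(\mathcal D_j)$ for every $k\ge0$. *)

(* Defs.v *)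
From HB Require Import structures.
From mathcomp Require Import all_boot all_order all_algebra finmap.
From mathcomp Require Import all_classical all_reals all_analysis homotopy.
Set Implicit Arguments.
Unset Strict Implicit.
Unset Printing Implicit Defensive.
Import Order.TTheory GRing.Theory Num.Theory.
Import numFieldNormedType.Exports.
Local Open Scope classical_set_scope.
Local Open Scope ring_scope.

(* A simplex is identified with its nonempty finite set of vertices; there is
   no empty simplex.  The vertices of C are the v with [fset v] in C, so
   elements of V that are not vertices of C play no role. *)
Definition simplicial_complex (V : choiceType) (C : set {fset V}) : Prop :=
  (forall s, C s -> s != fset0) /\
  (forall s t, C s -> t != fset0 -> (t `<=` s)%fset -> C t).

Definition subcomplex (V : choiceType) (D C : set {fset V}) : Prop :=
  simplicial_complex D /\ D `<=` C.

Definition dim (V : choiceType) (s : {fset V}) : nat := #|` s|.-1.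

Definition has_dimension (V : choiceType) (C : set {fset V}) (d : nat) : Prop :=
  (exists2 s, C s & dim s = d) /\ (forall s, C s -> (dim s <= d)%N).

Definition F (V : choiceType) (k : nat) (C : set {fset V}) : set {fset V} :=
  [set s | C s /\ dim s = k].

(* Only meaningful when F k C is finite: fset_set sends infinite sets to the
   empty one. *)
Definition beta (V : choiceType) (k : nat) (C : set {fset V}) : nat :=
  #|` fset_set (F k C)|.

Definition principal (V : choiceType) (C : set {fset V}) (s : {fset V}) : Prop :=
  C s /\ ~ exists t, [/\ C t, (s `<=` t)%fset & (dim s < dim t)%N].

(* The third condition is the inclusion of the (d-1)-skeleton; "< d" rather
   than "<= d.-1" makes this skeleton empty when d = 0. *)
Definition spanning_subcomplex (V : choiceType) (d : nat)
    (C D : set {fset V}) : Prop :=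
  [/\ simplicial_complex D, D `<=` C,
      (forall s, C s -> (dim s < d)%N -> D s) &
      (forall s, principal D s -> principal C s)].

Definition cofaces (V : choiceType) (C : set {fset V}) (s : {fset V}) :
    set {fset V} :=
  [set t | F (dim s).+1 C t /\ (s `<=` t)%fset].

(* Only meaningful when s has finitely many cofaces in C. *)
Definition degree (V : choiceType) (C : set {fset V}) (s : {fset V}) : nat :=
  #|` fset_set (cofaces C s)|.

(* Stated with equinumerosity rather than with [degree], so that an infinite
   degree is not mistaken for 0.  For d = 0, where there are no (d-1)-simplices,
   d.-1 is a junk value; only d > 0 is intended. *)
Definition regular (V : choiceType) (d n : nat) (C : set {fset V}) : Prop :=
  forall s, F d.-1 C s -> (cofaces C s #= `I_n)%card.

Definition total_degree (V : choiceType) (E X : set {fset V}) : nat :=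
  \sum_(s \in X) degree E s.

Definition generated (V : choiceType) (X : set {fset V}) : set {fset V} :=
  smallest (@simplicial_complex V) X.

Definition boundary (V : choiceType) (D D' : set {fset V}) : set {fset V} :=
  D' `&` generated (D `\` D').

Definition is_liminf (V : choiceType) (D : set {fset V})
    (Ds : nat -> set {fset V}) : Prop :=
  forall k, F k D = \bigcup_i \bigcap_(j in [set j | (i <= j)%N]) F k (Ds j).

(* Points are given by their barycentric coordinates. *)
Definition closed_simplex (R : realType) (V : choiceType) (s : {fset V}) :
    set (V -> R) :=
  [set x | [/\ forall v, 0 <= x v,
               forall v, v \notin s -> x v = 0 &
               \sum_(v <- s) x v = 1]].

Record realization (R : realType) (V : choiceType) (C : set {fset V}) : Type :=
  Realization {
    coords : V -> R;
    coordsP : exists2 s, C s & closed_simplex s coords }.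

HB.instance Definition _ (R : realType) (V : choiceType) (C : set {fset V}) :=
  gen_eqMixin (realization R C).
HB.instance Definition _ (R : realType) (V : choiceType) (C : set {fset V}) :=
  gen_choiceMixin (realization R C).

(* The weak (coherent) topology: U is open iff its trace on every closed
   simplex is relatively open.  Since only the finitely many coordinates in s
   can be nonzero on the closed simplex s, the topology that the latter
   inherits from {ptws V -> R} is the Euclidean one. *)
Definition realization_open (R : realType) (V : choiceType)
    (C : set {fset V}) (U : set (realization R C)) : Prop :=
  forall s, C s -> exists W : set {ptws V -> R}, open W /\
    forall x, closed_simplex s (coords x) -> (U x <-> W (coords x)).

Section RealizationTopology.
Variables (R : realType) (V : choiceType) (C : set {fset V}).

Lemma realization_openT : realization_open [set: realization R C].
Proof. by move=> s _; exists setT; split; first exact: openT. Qed.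

Lemma realization_openI : setI_closed (@realization_open R V C).
Proof.
move=> A B oA oB s Cs; have [W1 [oW1 h1]] := oA s Cs.
have [W2 [oW2 h2]] := oB s Cs.
exists (W1 `&` W2); split; first exact: openI.
move=> x sx; split=> [[/(h1 _ sx) ? /(h2 _ sx) ?]|[]]; first by split.
by move=> /(h1 _ sx) ? /(h2 _ sx) ?; split.
Qed.

Lemma realization_open_bigU (I : Type) (f : I -> set (realization R C)) :
  (forall i, realization_open (f i)) -> realization_open (\bigcup_i f i).
Proof.
move=> of_ s Cs; have [W hW] := choice (fun i => of_ i s Cs).
exists (\bigcup_i W i); split.
  by apply: bigcup_open => i _; have [] := hW i.
move=> x sx; split=> -[i _ ?]; exists i => //.
  by apply/((hW i).2 x sx).
by apply/((hW i).2 x sx).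
Qed.

HB.instance Definition _ := isOpenTopological.Build (realization R C)
  realization_openT realization_openI realization_open_bigU.

End RealizationTopology.

Definition homotopic (R : realType) (X Y : topologicalType) (f g : X -> Y) :
    Prop :=
  exists H : (X * R)%type -> Y,
    [/\ {within [set: X] `*` [set` `[0, 1]], continuous H},
        forall x, H (x, 0) = f x & forall x, H (x, 1) = g x].

Definition homotopy_equivalent (R : realType) (X Y : topologicalType) : Prop :=
  exists (f : X -> Y) (g : Y -> X),
    [/\ continuous f, continuous g,
        homotopic R (g \o f) id & homotopic R (f \o g) id].

Definition contractible (R : realType) (X : topologicalType) : Prop :=
  exists x0 : X, homotopic R (@id X) (fun=> x0).

Definition sphere (R : realType) (d : nat) : set 'rV[R]_d.+1 :=
  [set x | \sum_i x ord0 i ^+ 2 = 1].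
Arguments sphere : clear implicits.

Lemma sphere_basepoint_subproof (R : realType) (d : nat) :
  delta_mx ord0 ord0 \in sphere R d.
Proof.
rewrite inE /sphere /= (bigD1 ord0) //= big1 => [|i /negPf i0].
  by rewrite mxE !eqxx expr1n addr0.
by rewrite mxE eqxx i0 expr0n.
Qed.

Definition sphere_basepoint (R : realType) (d : nat) : sphere R d :=
  exist _ (delta_mx ord0 ord0) (sphere_basepoint_subproof R d).

(* The library's [wedge] carries the quotient topology of the disjoint union,
   also for infinite I; it is empty (not a point) when I is. *)
Definition bouquet (R : realType) (d : nat) (I : choiceType) : topologicalType :=
  wedge (fun _ : I => sphere_basepoint R d).

(* r = None stands for infinitely many spheres; since the complexes considered
   are countable, this means countably infinitely many. *)
Definition homotopy_equivalent_to_bouquet (R : realType) (X : topologicalType)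
    (d : nat) (r : option nat) : Prop :=
  match r with
  | Some 0%N => contractible R X
  | Some k => homotopy_equivalent R X (bouquet R d 'I_k)
  | None => homotopy_equivalent R X (bouquet R d nat)
  end.

Definition ereal_of_count (R : realType) (r : option nat) : \bar R :=
  if r is Some k then k%:R%:E else +oo%E.

(* Main.v *)
(* Write T for the set of simplices of C outside D.  They are all of dimension
   d, and their proper faces lie in D.  The contraction h of |D| extends to a
   homotopy G of |C| starting at the identity, by coning off h over each simplex
   of T from its barycenter.  Hence the map q collapsing |D| to a point is a
   homotopy equivalence: G(-, 1) factors through q.  Inverse stereographic
   projection identifies the quotient of each simplex of T by its boundary with
   a d-sphere, so q can be taken with values in the bouquet indexed by T, and
   r = #T.

   For the formula, a (d-1)-simplex s of D_i has n cofaces in C, which lie in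
   D_i, in D - D_i or in T.  Summing over s, the first kind contributes
   (d+1) beta_d(D_i) and the second one the total degree of the boundary, so
   that the expression is the number of pairs (s, t) of a facet s in D_i of some
   t in T, divided by d+1.  Each t in T has d+1 facets, all of them in D, hence
   eventually in D_i. *)
Require Import Defs.
From HB Require Import structures.
From mathcomp Require Import all_boot all_order all_algebra finmap.
From mathcomp Require Import all_classical all_reals all_analysis homotopy.
From mathcomp Require Import ring lra.
Set Implicit Arguments.
Unset Strict Implicit.
Unset Printing Implicit Defensive.
Import Order.TTheory GRing.Theory Num.Theory.
Import numFieldNormedType.Exports.
Local Open Scope classical_set_scope.
Local Open Scope ring_scope.

(** * Continuity on subsets *)

(** This pointwise form of relative openness has the shape of [realization_open], so continuity
    between realizations can be checked without handling subspace topologies. *)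
Lemma within_continuous_openP (X Y : topologicalType) (A : set X) (f : X -> Y) :
  {within A, continuous f} <->
  (forall U, open U -> exists2 W, open W & forall x, A x -> (U (f x) <-> W x)).
Proof.
split=> [/continuousP cf U /cf /open_subspaceP[W oW WE]|h].
  exists W => // x Ax; have := congr1 (fun S : set X => S x) WE.
  rewrite /setI /preimage /= => /propeqP[a b].
  split=> ?; first by have [] : W x /\ A x by exact: b.
  by have [] : U (f x) /\ A x by exact: a.
apply/continuousP => U /h[W oW WE]; apply/open_subspaceP; exists W => //.
apply/seteqP; split=> x [? Ax]; split=> //; first exact/(WE _ Ax).
exact/(WE _ Ax).
Qed.

Lemma within_comp (X Y Z : topologicalType) (A : set X) (B : set Y)
    (f : X -> Y) (g : Y -> Z) : (forall x, A x -> B (f x)) ->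
  {within A, continuous f} -> {within B, continuous g} ->
  {within A, continuous (g \o f)}.
Proof.
move=> AB /within_continuous_openP cf /within_continuous_openP cg.
apply/within_continuous_openP => U /cg[V oV VE]; have [W oW WE] := cf _ oV.
by exists W => // x Ax; rewrite -WE// -VE//; exact: AB.
Qed.

Lemma within_eq (X Y : topologicalType) (A : set X) (f g : X -> Y) :
  (forall x, A x -> f x = g x) ->
  {within A, continuous f} -> {within A, continuous g}.
Proof. by move=> fg; apply: subspace_eq_continuous => x /set_mem /fg. Qed.

Lemma within_continuousT (X Y : topologicalType) (f : X -> Y) :
  {within setT, continuous f} -> continuous f.
Proof.
move=> /subspace_continuousP h x U Ux; have := h x Logic.I U Ux.
by rewrite !nbhs_simpl /= /within /=; apply: filterS => z; apply.
Qed.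

Lemma within_pair (X Y Z : topologicalType) (A : set X) (f : X -> Y)
    (g : X -> Z) : {within A, continuous f} -> {within A, continuous g} ->
  {within A, continuous (fun x => (f x, g x))}.
Proof.
move=> /subspace_continuousP cf /subspace_continuousP cg.
apply/subspace_continuousP => x Ax; apply: cvg_pair; [exact: cf|exact: cg].
Qed.

(** The pasting lemma for finite closed covers, meant for the boundary of a simplex covered by its
    facets. *)
Lemma within_bigcup_seq (X Y : topologicalType) (I : choiceType) (s : seq I)
    (A : I -> set X) (f : X -> Y) : (forall i, i \in s -> closed (A i)) ->
  (forall i, i \in s -> {within A i, continuous f}) ->
  {within \bigcup_(i in [set` s]) A i, continuous f}.
Proof.
elim: s => [|i s IH] clA cf.
  suff -> : \bigcup_(i in [set` [::]]) A i = set0.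
    exact: continuous_subspace0.
  by apply/seteqP; split=> x // [].
have -> : \bigcup_(j in [set` i :: s]) A j =
    A i `|` \bigcup_(j in [set` s]) A j.
  apply/seteqP; split=> x.
    move=> [j /=]; rewrite in_cons => /predU1P[->|js Ajx]; first by left.
    by right; exists j.
  move=> [Aix|[j /= js Ajx]]; first by exists i => //=; rewrite mem_head.
  by exists j => //=; rewrite in_cons js orbT.
apply: withinU_continuous.
- by apply: clA; rewrite mem_head.
- apply: closed_bigcup => //.
  by move=> j /= js; apply: clA; rewrite in_cons js orbT.
- by apply: cf; rewrite mem_head.
- by apply: IH => j js; [apply: clA|apply: cf]; rewrite in_cons js orbT.
Qed.

(* Whitehead's lemma: a final topology stays final after multiplication by the
   locally compact space [0, 1]. *)
Lemma within_prod_itv (R : realType) (B Y : topologicalType) (J : Type)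
    (Z : J -> topologicalType) (S : forall j, set (Z j))
    (phi : forall j, Z j -> B) (F : B * R -> Y) :
  (forall b, exists j, exists2 z, S j z & phi j z = b) ->
  (forall U : set B, (forall j, exists2 W, open W &
     forall z, S j z -> (U (phi j z) <-> W z)) -> open U) ->
  (forall j, {within S j `*` [set` `[0, 1]],
     continuous (fun z => F (phi j z.1, z.2))}) ->
  {within setT `*` [set` `[0, 1]], continuous F}.
Proof.
move=> surj fin cF; apply/subspace_continuousP => -[b0 t0] [_ /= t01] N.
rewrite nbhsE => -[Q [oQ Qb0] QN].
have cF' j z t : S j z -> t \in `[0, 1] -> Q (F (phi j z, t)) ->
    \forall z' \near z & t' \near t, S j z' -> t' \in `[0, 1] ->
      Q (F (phi j z', t')).
  move=> Sz tI Qzt; have /subspace_continuousP := cF j.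
  move=> /(_ (z, t) (conj Sz tI) Q (open_nbhs_nbhs (conj oQ Qzt))).
  move=> [[A A'] [/= Az A't] AA]; exists (A, A') => //= -[z' t'] AA' Sz' t'I.
  by apply: (AA (z', t')).
have [j0 [z0 Sz0 z0E]] := surj b0.
have near_t0 : \forall t \near t0, t \in `[0, 1] -> Q (F (b0, t)).
  have := cF' j0 z0 t0 Sz0 t01; rewrite z0E => /(_ Qb0)[[U V] [/= Uz Vt] UV].
  apply: filterS Vt => t Vt tI; rewrite -z0E.
  by apply: (UV (z0, t)) => //; split => //; exact: nbhs_singleton.
have [e /= e0 he] := (nbhs_ballP _ _).1 near_t0.
(* Half of e keeps this closed interval inside the open ball of radius e around t0. *)
pose K := [set` `[0, 1]] `&` [set` `[t0 - e / 2, t0 + e / 2]].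
have cK : compact K.
  by apply: compact_closedI; [exact: segment_compact|exact: interval_closed].
have KQ t : K t -> Q (F (b0, t)).
  move=> [/= tI]; rewrite in_itv /= => /andP[t1 t2]; apply: he => //=.
  by rewrite /ball /= ltr_norml; apply/andP; split; lra.
(* Tube lemma: since K is compact, the set U of those b for which all of {b} x K goes into Q is
   open. *)
pose U := [set b | forall t, K t -> Q (F (b, t))].
have oU : open U.
  apply: fin => j.
  exists (interior [set z | S j z -> U (phi j z)]); first exact: open_interior.
  move=> z Sz; split; last by move=> /interior_subset; exact.
  move=> Uz; rewrite /interior /= .
  have /compact_near_coveringP/near_covering_withinP cov := cK.
  apply: filterS (cov (Z j) (nbhs z)
    (fun z' t => S j z' -> Q (F (phi j z', t))) _ _).
    by move=> z' h Sz' t /h; apply.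
  move=> t Kt; have [[A B'] [/= Az Bt] AB] := cF' j z t Sz Kt.1 (Uz _ Kt).
  exists (B', A) => //= -[t' z'] /= [B't' Az'] [t'I _] Sz'.
  exact: (AB (z', t')).
exists (U, [set` `[t0 - e / 2, t0 + e / 2]]) => /=.
  split; first by apply: open_nbhs_nbhs; split.
  rewrite nbhs_ballP; exists (e / 2); first by rewrite /= divr_gt0.
  move=> t /=; rewrite /ball /= ltr_norml in_itv /= => /andP[? ?].
  by apply/andP; split; lra.
by move=> [b t] /= [Ub tK] [_ tI]; apply: QN; exact: Ub.
Qed.

Section ContinuousArith.
Variables (R : realType) (Z : topologicalType) (f g : Z -> R).
Hypotheses (cf : continuous f) (cg : continuous g).

Lemma continuousDfun : continuous (fun z => f z + g z).
Proof. by move=> z; apply: cvgD; [exact: cf|exact: cg]. Qed.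

Lemma continuousBfun : continuous (fun z => f z - g z).
Proof. by move=> z; apply: cvgB; [exact: cf|exact: cg]. Qed.

Lemma continuousMfun : continuous (fun z => f z * g z).
Proof. by move=> z; apply: cvgM; [exact: cf|exact: cg]. Qed.

Lemma continuousMaxfun : continuous (fun z => Num.max (f z) (g z)).
Proof. by move=> z; apply: continuous_max; [exact: cf|exact: cg]. Qed.

Lemma continuousVfun : (forall z, f z != 0) -> continuous (fun z => (f z)^-1).
Proof. by move=> f0 z; apply: cvgV; [exact: f0|exact: cf]. Qed.

End ContinuousArith.

Lemma continuous_cstfun (X Y : topologicalType) (y : Y) :
  continuous (fun _ : X => y).
Proof. by move=> x; exact: cvg_cst. Qed.

Lemma fst_continuous (X Y : topologicalType) : continuous (@fst X Y).
Proof. by move=> x; exact: cvg_fst. Qed.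

Lemma snd_continuous (X Y : topologicalType) : continuous (@snd X Y).
Proof. by move=> x; exact: cvg_snd. Qed.

Lemma closed_preimage (X Y : topologicalType) (f : X -> Y) (D : set Y) :
  continuous f -> closed D -> closed (f @^-1` D).
Proof. by move=> cf; apply: preimage_closed => x _; exact: cf. Qed.

(** * Collapsing a subspace *)

(** Extended homotopies start at the identity, whereas [homotopy_equivalent] asks for homotopies
    that end there. *)
Lemma within_rev_itv (R : realType) (X Y : topologicalType) (F : X * R -> Y) :
  {within setT `*` [set` `[0, 1]], continuous F} ->
  {within setT `*` [set` `[0, 1]],
    continuous (fun z : X * R => F (z.1, 1 - z.2))}.
Proof.
move=> cF.
apply: (within_comp (f := fun z : X * R => (z.1, 1 - z.2)) (g := F) _ _ cF).
  move=> [x t] [_ /=]; rewrite in_itv /= => /andP[? ?]; split=> //=.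
  by rewrite in_itv /=; apply/andP; split; lra.
apply: within_pair; apply: continuous_subspaceT => z; first exact: cvg_fst.
by apply: cvgB; [exact: cvg_cst|exact: cvg_snd].
Qed.

(* The pair (X, A) has the homotopy extension property for the contraction of A
   that G extends; hence collapsing A, which q does, is a homotopy
   equivalence. *)
Lemma homotopy_equivalent_collapse (R : realType) (X B : topologicalType)
    (A : set X) (q : X -> B) (G : X * R -> X) :
  continuous q -> (forall b, exists x, q x = b) ->
  (forall U : set B, open (q @^-1` U) -> open U) ->
  (forall x x', A x -> A x' -> q x = q x') ->
  (forall x x', q x = q x' -> x = x' \/ A x /\ A x') ->
  {within setT `*` [set` `[0, 1]], continuous G} ->
  (forall x, G (x, 0) = x) ->
  (forall x (t : R), A x -> t \in `[0, 1] -> A (G (x, t))) ->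
  (forall x x', A x -> A x' -> G (x, 1) = G (x', 1)) ->
  homotopy_equivalent R X B.
Proof.
move=> cq qs qop qA qinj cG G0 GA G1.
(* This section of q need not be continuous. It enters only through maps that are constant on the
   fibers of q, and these are continuous on B because q is a quotient map. *)
have [sec secK] := choice qs.
have G1E x : G (sec (q x), 1) = G (x, 1).
  by have [->//|[? ?]] := qinj _ _ (secK (q x)); exact: G1.
have qGE x (t : R) : t \in `[0, 1] -> q (G (sec (q x), t)) = q (G (x, t)).
  move=> tI; have [->//|[Ax Ax']] := qinj _ _ (secK (q x)).
  by apply: qA; exact: GA.
have I1 : 1 \in `[0, 1 : R] by rewrite in_itv /= ler01 lexx.
pose g b := G (sec b, 1).
have cg : continuous g.
  apply/continuousP => U oU; apply: qop.
  rewrite (_ : _ @^-1` _ = (fun x => G (x, 1)) @^-1` U); last first.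
    by apply/seteqP; split=> x; rewrite /preimage /= /g G1E.
  have : {within setT, continuous (fun x => G (x, 1 : R))}.
    apply: (within_comp (f := fun x : X => (x, 1 : R)) (g := G) _ _ cG) => //.
    by apply: within_pair; apply: continuous_subspaceT => x;
      [exact: cvg_id|exact: cvg_cst].
  by move=> /within_continuousT/continuousP; exact.
have crG := within_rev_itv cG.
exists q, g; split=> //.
- exists (fun z => G (z.1, 1 - z.2)); split=> // x /=.
    by rewrite subr0 /g G1E.
  by rewrite subrr.
- exists (fun z => q (G (sec z.1, 1 - z.2))); split=> [|b|b] /=.
  (* Whitehead's lemma for the family whose only member is the quotient map q. *)
  + apply: (@within_prod_itv R B B unit (fun=> X) (fun=> setT) (fun=> q)).
    * by move=> b; exists tt; have [x <-] := qs b; exists x.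
    * move=> U /(_ tt)[W oW WE]; apply: qop.
      rewrite (_ : _ @^-1` _ = W) //.
      by apply/seteqP; split=> x; rewrite /preimage /= WE.
    * move=> _ /=.
      apply: (@within_eq _ _ _ (fun z : X * R => q (G (z.1, 1 - z.2)))).

        move=> [x t] [_ /=]; rewrite in_itv /= => /andP[? ?].
        by rewrite qGE// in_itv /=; apply/andP; split; lra.
      apply: (within_comp (B := setT) _ crG) => //.
      exact: continuous_subspaceT.
  + by rewrite subr0.
  + by rewrite subrr G0 secK.
Qed.

(** * Barycentric geometry of a simplex *)

Section SimplexGeometry.
Variables (R : realType) (V : choiceType).
Implicit Types (s t : {fset V}) (x y z : V -> R).

Lemma continuous_ptws (Z : topologicalType) (f : Z -> {ptws V -> R}) :
  (forall v, continuous (f ^~ v)) -> continuous f.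
Proof.
move=> cf p; apply/cvg_sup => v; apply/cvg_image.
  by apply/seteqP; split=> // r _; exists (fun=> r).
move=> W /(cf v p); rewrite !nbhs_simpl /= => h.
exists ((fun y : V -> R => y v) @^-1` W) => //.
by apply/seteqP; split=> [r [y Wy <-]//|r Wr]; exists (fun=> r).
Qed.

Lemma coord_ptws_continuous (v : V) :
  continuous (fun x : {ptws V -> R} => x v).
Proof. exact: (@proj_continuous V (fun=> R) v). Qed.

(** Let N be the number of vertices of s. On vectors supported in s with coordinate sum 0, this is
    the Minkowski functional of the simplex recentered at its barycenter: it is at most 1 iff z v >=
    -1/N for all v in s. *)
Definition gauge s z : R := \big[Num.max/0]_(v <- s) - (#|` s|%:R * z v).

Definition barycenter s (v : V) : R := if v \in s then #|` s|%:R^-1 else 0.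

(** On the closed simplex, a radial coordinate that is 0 at the barycenter and 1 exactly on the
    boundary. *)
Definition radius s x : R := gauge s (fun v => x v - barycenter s v).

Definition dilate s (l : R) x (v : V) : R :=
  barycenter s v + l * (x v - barycenter s v).

Lemma gauge_ge0 s z : 0 <= gauge s z.
Proof. exact: bigmax_ge_id. Qed.

Lemma le_gauge s z v : v \in s -> - (#|` s|%:R * z v) <= gauge s z.
Proof.
move=> vs; rewrite /gauge.
exact: (le_bigmax_seq 0 v predT (fun v => - (#|` s|%:R * z v)) vs).
Qed.

(** Positivity excludes that the maximum comes from the default value 0. *)
Lemma gauge_attained s z :
  0 < gauge s z -> exists2 v, v \in s & gauge s z = - (#|` s|%:R * z v).
Proof.
rewrite /gauge; move: (#|` s|%:R) => N.
suff H (r : seq V) : 0 < \big[Num.max/0]_(v <- r) - (N * z v) ->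
    exists2 v, v \in r & \big[Num.max/0]_(v <- r) - (N * z v) = - (N * z v).
  exact: H.
elim: r => [|v r IH]; first by rewrite big_nil ltxx.
rewrite big_cons; case: (leP (- (N * z v))) => _.
  by move=> /IH[w wr ->]; exists w => //; rewrite in_cons wr orbT.
by exists v => //; rewrite mem_head.
Qed.

Lemma gaugeZ s (l : R) z :
  0 <= l -> gauge s (fun v => l * z v) = l * gauge s z.
Proof.
move=> l0; rewrite /gauge; move: (#|` s|%:R) => N;
  elim: (s : seq V) => [|v r IH].
  by rewrite !big_nil mulr0.
by rewrite !big_cons IH maxr_pMr// mulrN mulrCA.
Qed.

Lemma gauge_ext s z z' : {in s, z =1 z'} -> gauge s z = gauge s z'.
Proof. by move=> zz'; apply: eq_big_seq => v vs; rewrite zz'. Qed.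

Lemma radius_ge0 s x : 0 <= radius s x. Proof. exact: gauge_ge0. Qed.

Lemma card_gt0R s v : v \in s -> 0 < #|` s|%:R :> R.
Proof. by move=> vs; rewrite ltr0n cardfs_gt0; apply/fset0Pn; exists v. Qed.

(** With N vertices, -N (x v - 1/N) = 1 - N x v, which is at most 1 iff x v >= 0. *)
Lemma radius_le1 s x : radius s x <= 1 <-> {in s, forall v, 0 <= x v}.
Proof.
split=> [r1 v vs|x0].
  have := le_trans (le_gauge _ vs) r1; rewrite /barycenter vs.
  have N0 := card_gt0R vs; rewrite mulrBr divff ?gt_eqF// opprB lerBlDr addrC.
  by rewrite -lerBlDr subrr pmulr_rge0.
rewrite /radius /gauge big_seq; apply: bigmax_le => // v vs;
  rewrite /barycenter vs.
have N0 := card_gt0R vs; rewrite mulrBr divff ?gt_eqF// opprB lerBlDr.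
by rewrite lerDl; apply: mulr_ge0; [exact: ltW|exact: x0].
Qed.

Lemma sum_barycenter s : s != fset0 -> \sum_(v <- s) barycenter s v = 1.
Proof.
move=> /fset0Pn[v vs]; rewrite (eq_big_seq (fun=> #|` s|%:R^-1)) => [|w ws].
  rewrite big_const_seq count_predT iter_addr_0 -(mulr_natr _^-1) mulVf//.
  by rewrite gt_eqF// (card_gt0R vs).
by rewrite /barycenter ws.
Qed.

Lemma closed_simplexP s x : closed_simplex s x <->
  [/\ radius s x <= 1, forall v, v \notin s -> x v = 0 & \sum_(v <- s) x v = 1].
Proof.
split=> -[a b c]; split=> //; first by apply/radius_le1 => v _; exact: a.
move=> v; have [vs|/b->//] := boolP (v \in s).
by move/radius_le1 : a; apply.
Qed.

Lemma closed_simplex_neq0 s x : closed_simplex s x -> s != fset0.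
Proof.
move=> [_ _ s1]; apply/eqP => s0; move: s1; rewrite s0 big_seq_fset0 => /eqP.
by rewrite eq_sym oner_eq0.
Qed.

Lemma closed_simplex_le1 s x v : closed_simplex s x -> x v <= 1.
Proof.
move=> [x0 xs x1]; have [vs|/xs->] := boolP (v \in s); last exact: ler01.
by rewrite -x1 (big_fsetD1 v)//= lerDl; apply: sumr_ge0.
Qed.

Lemma closed_simplex_face s x v : closed_simplex s x -> x v = 0 ->
  closed_simplex (s `\ v)%fset x.
Proof.
move=> [x0 xs x1] xv; split=> // [w|].
  by rewrite in_fsetD1 negb_and negbK => /orP[/eqP->|/xs].
rewrite -x1; apply: big_fset_incl; first exact: fsubD1set.
by move=> w ws; rewrite in_fsetD1 ws andbT negbK => /eqP->.
Qed.

(** The radius 1 is positive, hence attained at some vertex v, and 1 - N x v = 1 means x v = 0. *)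
Lemma radius_eq1 s x : closed_simplex s x -> radius s x = 1 <->
  exists2 v, v \in s & x v = 0.
Proof.
move=> sx; split=> [r1|[v vs xv]]; last first.
  have [r1 _ _] := (closed_simplexP s x).1 sx.
  apply/eqP; rewrite eq_le r1 /=.
  apply: le_trans (le_gauge _ vs); rewrite xv /barycenter vs sub0r mulrN opprK.
  by rewrite divff// gt_eqF// (card_gt0R vs).
have [|v vs] := @gauge_attained s (fun v => x v - barycenter s v).
  by rewrite -/(radius s x) r1.
rewrite -/(radius s x) r1 /barycenter vs mulrBr divff ?gt_eqF ?(card_gt0R vs)//.
rewrite opprB => /eqP; rewrite eq_sym subr_eq -subr_eq0 opprD addNKr oppr_eq0.
by rewrite mulf_eq0 gt_eqF ?(card_gt0R vs)//= => /eqP xv; exists v.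
Qed.

(** At an interior point no coordinate over s vanishes, so every simplex through it has all vertices
    of s. *)
Lemma radius_lt1 s x : closed_simplex s x -> radius s x != 1 ->
  forall t, closed_simplex t x -> (s `<=` t)%fset.
Proof.
move=> sx r1 t tx; apply/fsubsetP => v vs; apply: contraNT r1 => vt.
by apply/eqP/(radius_eq1 sx); exists v => //; case: tx => _ + _; exact.
Qed.

Lemma radius_dilate s l x : 0 <= l -> radius s (dilate s l x) = l * radius s x.
Proof.
by move=> l0; rewrite -gaugeZ//; apply: gauge_ext => v _;
  rewrite /dilate addrC addKr.
Qed.

Lemma dilate1 s x : dilate s 1 x = x.
Proof. by apply/funext => v; rewrite /dilate mul1r addrC subrK. Qed.

Lemma closed_simplex_dilate s l x : closed_simplex s x -> 0 <= l ->
  l * radius s x <= 1 -> closed_simplex s (dilate s l x).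
Proof.
move=> /[dup] sx /closed_simplexP[_ xs x1] l0 lr.
apply/closed_simplexP; split; first by rewrite radius_dilate.
  by move=> v vs; rewrite /dilate /barycenter (negPf vs) xs// subr0 mulr0 addr0.
rewrite big_split /= -mulr_sumr sumrB x1 sum_barycenter ?(closed_simplex_neq0
  sx)//.
by rewrite subrr mulr0 addr0.
Qed.

Lemma radius_continuous s : continuous (radius s : {ptws V -> R} -> R).
Proof.
apply: continuous_big => [|v _ x]; first exact: max_continuous.
apply: (@continuous_comp _ _ _ (fun x : {ptws V -> R} => x v)
  (fun r : R => - (#|` s|%:R * (r - barycenter s v)))).
  exact: coord_ptws_continuous.
apply: cvgN; apply: cvgM; first exact: cvg_cst.
by apply: cvgB; [exact: cvg_id|exact: cvg_cst].
Qed.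

Lemma dilate_continuous (Z : topologicalType) s (l : Z -> R)
    (f : Z -> {ptws V -> R}) : continuous l -> continuous f ->
  continuous (fun p => dilate s (l p) (f p) : {ptws V -> R}).
Proof.
move=> cl cf; apply: continuous_ptws => v p.
apply: cvgD; first exact: cvg_cst.
apply: cvgM; first exact: cl.
apply: cvgB; last exact: cvg_cst.
apply: (@continuous_comp _ _ _ f (fun x : {ptws V -> R} => x v));
  first exact: cf.
exact: coord_ptws_continuous.
Qed.

Lemma closed_closed_simplex s : closed (closed_simplex s : set {ptws V -> R}).
Proof.
rewrite (_ : closed_simplex s = \bigcap_v [set x | 0 <= x v] `&`
  \bigcap_(v in [set v | v \notin s]) [set x | x v = 0] `&`
  [set x | \sum_(v <- s) x v = 1]); last first.
  apply/seteqP; split=> x /=.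
    by move=> [? ? ?]; split=> //; split=> v //= ?; auto.
  by move=> [[a b] c]; split=> [v|v vs|]; [exact: a|exact: b|exact: c].
apply: closedI; [apply: closedI|].
- apply: closed_bigI => v _.
  apply: (@closed_preimage {ptws V -> R} R (fun x => x v) [set r | 0 <= r]).
    exact: coord_ptws_continuous.
  exact: closed_ge.
- apply: closed_bigI => v _.
  apply: (@closed_preimage {ptws V -> R} R (fun x => x v) [set r | r = 0]).
    exact: coord_ptws_continuous.
  exact: closed_eq.
- have cs : continuous (fun x : {ptws V -> R} => \sum_(v <- s) x v).
    apply: (@continuous_big R V +%R 0 predT); first exact: add_continuous.
    by move=> v _; exact: coord_ptws_continuous.
  apply: (@closed_preimage {ptws V -> R} R _ [set r | r = 1] cs).
  exact: closed_eq.
Qed.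

(** V may be infinite: the simplex is closed in the cube [0, 1]^V, which is compact by Tychonoff. *)
Lemma compact_closed_simplex s : compact (closed_simplex s : set {ptws V -> R}).
Proof.
apply: (@subclosed_compact {ptws V -> R} _
  [set x : {ptws V -> R} | forall v, [set` `[0, 1 : R]] (x v)]).
- exact: closed_closed_simplex.
- apply: (@tychonoff V (fun=> R) (fun=> [set` `[0, 1 : R]])) => _.
  exact: segment_compact.
- move=> x sx v /=; rewrite in_itv /= (closed_simplex_le1 _ sx) andbT.
  by case: sx.
Qed.

End SimplexGeometry.

(** * Realizations and homotopy extension *)

Section Realization.
Variables (R : realType) (V : choiceType).

Lemma coords_inj (C : set {fset V}) : injective (@coords R V C).
Proof.
move=> [x xP] [y yP] /= xy; move: xP yP; rewrite xy => xP yP.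
by congr Realization; exact: Prop_irrelevance.
Qed.

(** A total inverse of [coords], with default x0 off the realization. It allows maps on a
    realization to be studied on subsets of the fixed space [{ptws V -> R}]. *)
Definition realize (C : set {fset V}) (x0 : realization R C)
    (y : {ptws V -> R}) : realization R C :=
  if pselect (exists2 s, C s & closed_simplex s y) is left p
  then Realization p else x0.

Lemma realizeK (C : set {fset V}) (x0 : realization R C) s y :
  C s -> closed_simplex s y -> coords (realize x0 y) = y.
Proof. by move=> Cs sy; rewrite /realize; case: pselect => // -[];
  exists s. Qed.

Lemma coordsK (C : set {fset V}) (x0 x : realization R C) :
  realize x0 (coords x) = x.
Proof.
by have [s Cs sx] := coordsP x; apply: coords_inj; rewrite (realizeK _ Cs).
Qed.

Lemma realize_continuous (C : set {fset V}) (x0 : realization R C) s :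
  C s -> {within (closed_simplex s : set {ptws V -> R}),
    continuous (realize x0)}.
Proof.
move=> Cs; apply/within_continuous_openP => U oU; have [W [oW WE]] := oU s Cs.
by exists W => // y sy; rewrite WE ?(realizeK _ Cs).
Qed.

(** Recasts the weak topology as the final topology for the maps [realize x0] on closed simplices,
    the form that [within_prod_itv] takes. *)
Lemma realization_final (C : set {fset V}) (x0 : realization R C)
    (U : set (realization R C)) :
  (forall s, C s -> exists2 W : set {ptws V -> R}, open W &
     forall y, closed_simplex s y -> (U (realize x0 y) <-> W y)) -> open U.
Proof.
move=> UW; change (realization_open U) => s Cs; have [W oW WE] := UW s Cs;
  exists W; split=> // x sx.
by rewrite -WE// coordsK.
Qed.

Lemma continuous_realization (C : set {fset V}) (x0 : realization R C)
    (Y : topologicalType) (f : realization R C -> Y) :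
  (forall s, C s -> {within (closed_simplex s : set {ptws V -> R}),
    continuous (f \o realize x0)}) -> continuous f.
Proof.
move=> cf; apply/continuousP => U oU; apply: (@realization_final _ x0) => s Cs.
by have /within_continuous_openP/(_ U oU) := cf s Cs.
Qed.

Lemma within_realization_itv (C : set {fset V}) (x0 : realization R C)
    (Y : topologicalType) (f : realization R C * R -> Y) :
  (forall s, C s ->
    {within (closed_simplex s : set {ptws V -> R}) `*` [set` `[0, 1]],
      continuous (fun p : {ptws V -> R} * R => f (realize x0 p.1, p.2))}) ->
  {within setT `*` [set` `[0, 1]], continuous f}.
Proof.
move=> cf; apply: (@within_prod_itv R _ Y {s | C s} (fun=> {ptws V -> R})
  (fun s => closed_simplex (sval s)) (fun=> realize x0)).
- move=> x; have [s Cs sx] := coordsP x.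
  by exists (exist _ s Cs), (coords x) => //; exact: coordsK.
- move=> U UW; apply: (@realization_final _ x0) => s Cs.
  exact: (UW (exist _ s Cs)).
- by move=> [s Cs]; exact: cf.
Qed.

(** * Extending a homotopy of |D| when all proper faces of simplices of C lie in D *)

Variables (C D : set {fset V}).
Hypothesis cD : simplicial_complex D.
Hypothesis DC : D `<=` C.
Hypothesis properD : forall s t, C s -> t != fset0 ->
  (t `<=` s)%fset -> t != s -> D t.

Definition realization_sub : set (realization R C) :=
  [set x | exists2 s, D s & closed_simplex s (coords x)].

Lemma maximal_simplex s t :
  C t -> s != fset0 -> ~ D s -> (s `<=` t)%fset -> t = s.
Proof.
move=> Ct s0 Ds st; apply/eqP; rewrite eq_sym; apply/negPn/negP => st'.
by apply: Ds; exact: (properD Ct).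
Qed.

Lemma interior_sub s x : C s -> ~ D s -> closed_simplex s (coords x) ->
  radius s (coords x) != 1 -> ~ realization_sub x.
Proof.
move=> Cs Ds sx r1 [t Dt tx]; apply: Ds.
exact: (cD.2 _ _ Dt (closed_simplex_neq0 sx) (radius_lt1 sx r1 tx)).
Qed.

(** A simplex through an interior point of s contains s; were it larger, s would be a proper face
    and so lie in D. Hence an arbitrary choice of a simplex containing such a point always yields
    s. *)
Lemma interior_unique s t (y : V -> R) : C s -> ~ D s -> closed_simplex s y ->
  radius s y != 1 -> C t -> closed_simplex t y -> t = s.
Proof.
move=> Cs Ds sy r1 Ct ty; apply: maximal_simplex => //.
  exact: closed_simplex_neq0 sy.
exact: radius_lt1 sy r1 _ ty.
Qed.

Lemma facet_in s v : C s -> v \in s -> (s `\ v)%fset != fset0 ->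
  D (s `\ v)%fset.
Proof.
move=> Cs vs sv0; apply: (properD Cs) => //; first exact: fsubD1set.
by apply: contraTneq vs => <-; rewrite in_fsetD1 eqxx.
Qed.

Lemma boundary_sub s (y : V -> R) : C s -> closed_simplex s y ->
  radius s y = 1 -> exists v, [/\ v \in s, D (s `\ v)%fset &
    closed_simplex (s `\ v)%fset y].
Proof.
move=> Cs sy /(radius_eq1 sy)[v vs yv].
have svy := closed_simplex_face sy yv; exists v; split=> //.
by apply: facet_in => //; exact: closed_simplex_neq0 svy.
Qed.

Lemma closed_simplex0 : closed_simplex fset0 = set0 :> set (V -> R).
Proof. by apply/seteqP; split=> // y /closed_simplex_neq0; rewrite eqxx. Qed.

Lemma realize_boundary_continuous (x0 : realization R D) s : C s ->
  {within \bigcup_(v in [set` enum_fset s])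
      (closed_simplex (s `\ v)%fset : set {ptws V -> R}),
    continuous (realize x0)}.
Proof.
move=> Cs; apply: within_bigcup_seq => v vs.
  exact: closed_closed_simplex.
(* If s is a single vertex, removing it leaves [fset0], whose closed simplex is empty. *)
have [->|sv0] := eqVneq (s `\ v)%fset fset0.
  by rewrite closed_simplex0; exact: continuous_subspace0.
by apply: realize_continuous; exact: facet_in.
Qed.

Variables (a : realization R D) (h : realization R D * R -> realization R D).
Hypothesis ch : {within setT `*` [set` `[0, 1]], continuous h}.
Hypothesis h0 : forall x, h (x, 0) = x.

Lemma inclusion_subproof (x : realization R D) :
  exists2 s, C s & closed_simplex s (coords x).
Proof. by have [s /DC Cs sx] := coordsP x; exists s. Qed.

Definition inclusion (x : realization R D) : realization R C :=
  Realization (inclusion_subproof x).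

Let retr := realize (inclusion a).

Lemma inclusion_continuous : continuous inclusion.
Proof.
apply: (@continuous_realization _ a) => s Ds.
apply: (@within_eq _ _ _ (realize (inclusion a))).
  by move=> y sy; apply: coords_inj;
    rewrite (realizeK _ (DC Ds))//= (realizeK _ Ds).
by apply: realize_continuous; exact: DC.
Qed.

(* The graph of h over the boundary of s is glued to the identity on the bottom
   along a cone: dilating from the barycenter by 1 + t pushes the outer part of
   s to the boundary, and the excess over the boundary is used as the time
   parameter of h. *)
Definition collar s (p : {ptws V -> R} * R) : realization R C :=
  if radius s p.1 * (1 + p.2) <= 1 then retr (dilate s (1 + p.2) p.1)
  else inclusion (h (realize a (dilate s (Num.max (radius s p.1) 2^-1)^-1 p.1),
                     radius s p.1 * (1 + p.2) - 1)).

(** On the outer part of the prism r >= 1/(1 + t) >= 1/2, so the truncation at 1/2 in [collar]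
    leaves r unchanged there; it makes the inverse continuous everywhere. *)
Lemma max_radius (r t : R) : 0 <= t <= 1 -> 1 <= r * (1 + t) ->
  Num.max r 2^-1 = r.
Proof.
move=> /andP[t0 t1] rt; apply/max_idPl; rewrite leNgt; apply/negP => r2.
by have : r * (1 + t) < 2^-1 * 2; nra.
Qed.

(** The prism is the union of two closed parts, where radius * (1 + t) is at most 1 and at least 1.
    On their overlap the time given to h is 0 and the dilated point lies on the boundary, so both
    formulas agree by [h0]. *)
Lemma within_collar s : C s ->
  {within (closed_simplex s : set {ptws V -> R}) `*` [set` `[0, 1]],
    continuous (collar s)}.
Proof.
move=> Cs; set S := _ `*` _.
pose f (p : {ptws V -> R} * R) := radius s p.1 * (1 + p.2).
have cr : continuous (fun p : {ptws V -> R} * R => radius s p.1).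
  by move=> p; apply: continuous_comp;
    [exact: cvg_fst|exact: radius_continuous].
have c1 : continuous (fun p : {ptws V -> R} * R => 1 + p.2).
  by apply: continuousDfun; [exact: continuous_cstfun|exact: snd_continuous].
have cf : continuous f.
  exact: continuousMfun.
have clS : closed S.
  apply: closedI.
    apply: (@closed_preimage ({ptws V -> R} * R)%type {ptws V -> R} fst).
      exact: fst_continuous.
    exact: closed_closed_simplex.
  apply: (@closed_preimage ({ptws V -> R} * R)%type R snd).
    exact: snd_continuous.
  exact: interval_closed.
have SE : S = (S `&` [set p | f p <= 1]) `|` (S `&` [set p | 1 <= f p]).
  rewrite -setIUr; apply/esym/setIidPl => p _ /=.
  by have [/ltW|] := ltP (f p) 1; [left|right].
suff : {within (S `&` [set p | f p <= 1]) `|` (S `&` [set p | 1 <= f p]),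
    continuous (collar s)} by rewrite -SE.
apply: withinU_continuous.
- apply: closedI => //; apply: (@closed_preimage _ R f [set r | r <= 1] cf);
    exact: closed_le.
- apply: closedI => //; apply: (@closed_preimage _ R f [set r | 1 <= r] cf);
    exact: closed_ge.
- apply: (@within_eq _ _ _ (fun p : {ptws V -> R} * R =>
    retr (dilate s (1 + p.2) p.1))).
    by move=> p [_ /=]; rewrite /collar /f => ->.
  apply: (within_comp (B := (closed_simplex s : set {ptws V -> R})) (g := retr)
    (f := fun p : {ptws V -> R} * R =>
      dilate s (1 + p.2) p.1 : {ptws V -> R})).
  + move=> [y t] [[/= sy]]; rewrite in_itv /= /f /= => /andP[t0 t1] ft.
    by apply: closed_simplex_dilate => //; [lra|rewrite mulrC].
  + apply: continuous_subspaceT; apply: (dilate_continuous c1) => p.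
    exact: cvg_fst.
  + exact: realize_continuous.
- apply: (@within_eq _ _ _ (fun p : {ptws V -> R} * R => inclusion (h (realize a
      (dilate s (Num.max (radius s p.1) 2^-1)^-1 p.1),
      radius s p.1 * (1 + p.2) - 1)))).
    move=> [y t] [[/= sy]]; rewrite in_itv /= /collar /f /= => t01 ft.
    case: ifPn => // ft'; have {ft ft'}ft : radius s y * (1 + t) = 1.
      by apply/eqP; rewrite eq_le ft ft'.
    have rt : (Num.max (radius s y) 2^-1)^-1 = 1 + t.
      rewrite (max_radius t01) ?ft//.
      have r0 : radius s y != 0.
        by apply/eqP => r0; move/eqP: ft; rewrite r0 mul0r eq_sym oner_eq0.
      by rewrite -[RHS](mulKf r0) ft mulr1.
    rewrite ft subrr h0 rt; apply: coords_inj.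
    have sd : closed_simplex s (dilate s (1 + t) y).
      by apply: closed_simplex_dilate => //; [lra|rewrite mulrC ft].
    rewrite (realizeK _ Cs)//=.
    have [|v [vs Dv vy]] := boundary_sub Cs sd.
      by rewrite radius_dilate; [rewrite mulrC|lra].
    by rewrite (realizeK _ Dv).
  pose e (p : {ptws V -> R} * R) : {ptws V -> R} :=
    dilate s (Num.max (radius s p.1) 2^-1)^-1 p.1.
  apply: (within_comp (B := setT) (g := inclusion)
    (f := fun p : {ptws V -> R} * R => h (realize a (e p), f p - 1))) => //;
      last first.
    by apply: continuous_subspaceT; exact: inclusion_continuous.
  apply: (within_comp (g := h)
    (B := [set: realization R D] `*` [set` `[0, 1 : R]])
    (f := fun p : {ptws V -> R} * R => (realize a (e p), f p - 1))) => //.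
    move=> [y t] [[/= sy]]; rewrite in_itv /= /f /= => /andP[t0 t1] ft.
    split=> //; rewrite /= in_itv /=; apply/andP; split; first lra.
    have [r1 _ _] := (closed_simplexP s y).1 sy.
    have r0 := radius_ge0 s y; nra.
  apply: within_pair; last first.
    apply: continuous_subspaceT; apply: (continuousBfun cf).
    exact: continuous_cstfun.
  (* On the outer part e divides by the radius, so it is the radial projection to the boundary of s,
     which is covered by facets belonging to D. *)
  apply: (within_comp (B := \bigcup_(v in [set` enum_fset s])
      (closed_simplex (s `\ v)%fset : set {ptws V -> R})) (g := realize a)
      (f := e)).
  + move=> [y t] [[/= sy]]; rewrite in_itv /= /f /= => t01 ft.
    rewrite /e /= (max_radius t01 ft).
    have r0 : 0 < radius s y.
      by rewrite lt_neqAle eq_sym radius_ge0 andbT; apply/eqP => r0; move: ft;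
        rewrite r0; lra.
    have rr : (radius s y)^-1 * radius s y = 1 by rewrite mulVf// gt_eqF.
    have [| |v [vs _ vy]] := @boundary_sub s (dilate s (radius s y)^-1 y) Cs.
    * by apply: closed_simplex_dilate => //; [rewrite invr_ge0 ltW|rewrite rr].
    * by rewrite radius_dilate ?rr// invr_ge0 ltW.
    * by exists v.
  + apply: continuous_subspaceT; apply: dilate_continuous;
      last exact: fst_continuous.
    apply: continuousVfun => [|p].
      by apply: (continuousMaxfun cr); exact: continuous_cstfun.
    by rewrite gt_eqF// lt_max invr_gt0 ltr0n orbT.
  + exact: realize_boundary_continuous.
Qed.

(** A point off |D| is interior to exactly one missing simplex, and G follows the collar of that
    simplex. Continuity is then checked on each prism over a closed simplex. *)
Lemma homotopy_extension : exists G : realization R C * R -> realization R C,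
  [/\ {within setT `*` [set` `[0, 1]], continuous G},
      forall x, G (x, 0) = x &
      forall x t, G (inclusion x, t) = inclusion (h (x, t))].
Proof.
pose sx (x : realization R C) : {fset V} := sval (cid2 (coordsP x)).
pose G p := if pselect (realization_sub p.1)
  then inclusion (h (realize a (coords p.1), p.2))
  else collar (sx p.1) (coords p.1, p.2).
have GD x t : G (inclusion x, t) = inclusion (h (x, t)).
  rewrite /G /=; case: pselect => [?|[]] /=; first by rewrite coordsK.
  by have [s Ds sy] := coordsP x; exists s.
(* The collar formula is valid on the boundary of s as well: there the radius is 1, so the
   projection fixes the point and h receives the time t. *)
have GC s y (t : R) : C s -> ~ D s -> closed_simplex s y -> 0 <= t <= 1 ->
    G (retr y, t) = collar s (y, t).
  move=> Cs Ds sy t01; rewrite /G /=.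
  have cy : coords (retr y) = y by rewrite (realizeK _ Cs).
  have [r1|r1] := eqVneq (radius s y) 1.
    have [v [vs Dv vy]] := boundary_sub Cs sy r1.
    case: pselect => [?|[]] /=; last by exists (s `\ v)%fset => //; rewrite cy.
    rewrite cy /collar /= r1 mul1r.
    case: ifPn => [t0'|t0'].
      have -> : t = 0 by lra.
      rewrite h0 addr0 dilate1; apply: coords_inj.
      by rewrite (realizeK _ Cs)//= (realizeK _ Dv).
    rewrite (_ : Num.max 1 2^-1 = 1); last by apply/max_idPl; lra.
    by rewrite invr1 dilate1 addrC addKr.
  case: pselect => [yD|?] /=.
    by have := @interior_sub s (retr y) Cs Ds; rewrite cy => /(_ sy r1).
  rewrite cy (_ : sx (retr y) = s)//; rewrite /sx.
  case: cid2 => s' /= Cs'; rewrite cy => s'y.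
  exact: (interior_unique Cs Ds sy r1).
exists G; split=> //.
- apply: (@within_realization_itv _ (inclusion a)) => s Cs.
  have [Ds|Ds] := pselect (D s).
    apply: (@within_eq _ _ _ (fun p : {ptws V -> R} * R =>
      inclusion (h (realize a p.1, p.2)))).
      move=> [y t] [/= sy t01]; rewrite -GD; congr (G (_, t)).
      by apply: coords_inj; rewrite (realizeK _ Cs)//= (realizeK _ Ds).
    apply: (within_comp (B := setT) (g := inclusion)
      (f := fun p : {ptws V -> R} * R => h (realize a p.1, p.2))) => //;
        last first.
      by apply: continuous_subspaceT; exact: inclusion_continuous.
    apply: (within_comp (g := h)
      (B := [set: realization R D] `*` [set` `[0, 1 : R]])
      (f := fun p : {ptws V -> R} * R => (realize a p.1, p.2))) => //.
      by move=> p [].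
    apply: within_pair; last by apply: continuous_subspaceT => p;
      exact: cvg_snd.
    apply: (within_comp (B := (closed_simplex s : set {ptws V -> R}))
      (g := realize a) (f := fst)).
    + by move=> p [].
    + by apply: continuous_subspaceT => p; exact: cvg_fst.
    + exact: realize_continuous.
  apply: (@within_eq _ _ _ (collar s)); last exact: within_collar.
  by move=> [y t] [/= sy]; rewrite in_itv /= => t01; rewrite (GC s).
- move=> x; have [s Cs sy] := coordsP x; rewrite -(coordsK (inclusion a) x).
  have [Ds|Ds] := pselect (D s).
    rewrite (_ : realize _ _ = inclusion (realize a (coords x))).
      by rewrite GD h0.
    by apply: coords_inj; rewrite (realizeK _ Cs)//= (realizeK _ Ds).
  rewrite (GC s) ?lexx ?ler01// /collar /= addr0 mulr1 dilate1.
  by have [-> _ _] := (closed_simplexP s (coords x)).1 sy.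
Qed.

End Realization.

(** * From a simplex to a sphere *)

Lemma continuous_row (R : realType) (Z : topologicalType) n
    (f : Z -> 'rV[R]_n.+1) (z : Z) :
  (forall j, {for z, continuous (fun z => f z ord0 j)}) ->
  {for z, continuous f}.
Proof.
move=> cf; apply/cvg_ballP => e e0.
have : \forall z' \near z, forall j, ball (f z ord0 j) e (f z' ord0 j).
  by apply: filter_forall => j; have /cvg_ballP := cf j; exact.
by apply: filterS => z' h; split=> // i j; rewrite (ord1 i).
Qed.

Section SphereMap.
Variables (R : realType) (V : choiceType) (d : nat) (s : {fset V}) (v0 : V).
Hypothesis card_s : #|` s| = d.+1.
Implicit Types (x y : {ptws V -> R}) (u : 'I_d.+1 -> R).

Let vertex (j : 'I_d.+1) : V := nth v0 s j.

Lemma sum_vertex (f : V -> R) : \sum_(v <- s) f v = \sum_j f (vertex j).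
Proof. by rewrite (big_nth v0) big_mkord card_s. Qed.

Lemma vertex_in j : vertex j \in s.
Proof. by apply: mem_nth; rewrite card_s. Qed.

Lemma vertexP v : v \in s -> exists j, v = vertex j.
Proof.
move=> vs; have vi : (index v s < d.+1)%N by rewrite -card_s index_mem.
by exists (Ordinal vi); rewrite /vertex /= nth_index.
Qed.

Definition offset y (j : 'I_d.+1) : R :=
  y (vertex j) - barycenter R s (vertex j).

(** Offsets sum to 0, so the coordinate at [ord0] is determined by the others; dropping it
    identifies their hyperplane with R^d. *)
Definition sqnorm u : R := \sum_(j | j != ord0) u j ^+ 2.

Lemma sqnorm_ge0 u : 0 <= sqnorm u.
Proof. by apply: sumr_ge0 => j _; exact: sqr_ge0. Qed.

Lemma sum_offset y : closed_simplex s y -> \sum_j offset y j = 0.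
Proof.
move=> sy; rewrite sumrB -!sum_vertex
  (sum_barycenter _ (closed_simplex_neq0 sy)).
by case: sy => _ _ ->; rewrite subrr.
Qed.

Lemma sqnorm_eq0 u : \sum_j u j = 0 -> sqnorm u = 0 -> forall j, u j = 0.
Proof.
move=> u0 /eqP; rewrite psumr_eq0 => [/allP un j|j _]; last exact: sqr_ge0.
have un' i : i != ord0 -> u i = 0.
  move=> i0; have := un i (mem_index_enum _).
  by rewrite i0 /= sqrf_eq0 => /eqP.
have [->|/un'//] := eqVneq j ord0.
by move: u0; rewrite (bigD1 ord0)//= big1 ?addr0.
Qed.

Definition depth y : R := 1 - radius s y.

Definition denominator y : R := sqnorm (offset y) + depth y ^+ 2.

(** The offset vanishes only at the barycenter, and there the depth is 1. *)
Lemma denominator_gt0 y : closed_simplex s y -> 0 < denominator y.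
Proof.
move=> sy; rewrite lt_neqAle eq_sym addr_ge0 ?sqnorm_ge0 ?sqr_ge0// andbT.
apply/negP; rewrite paddr_eq0 ?sqnorm_ge0 ?sqr_ge0// sqrf_eq0 => /andP[/eqP n0].
have o0 := sqnorm_eq0 (sum_offset sy) n0.
suff -> : depth y = 1 by rewrite oner_eq0.
suff r0 : radius s y <= 0.
  by rewrite /depth (_ : radius s y = 0) ?subr0//; apply/eqP;
    rewrite eq_le r0 radius_ge0.
rewrite /radius /gauge big_seq; apply: bigmax_le => // v vs.
have [j ->] := vertexP vs; have := o0 j; rewrite /offset => ->.
by rewrite mulr0 oppr0.
Qed.

(* Inverse stereographic projection from the basepoint, precomposed with the
   radial rescaling y |-> y / depth y of the open simplex to R^d. *)
Definition sphere_row y : 'rV[R]_d.+1 := \row_j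
  (if j == ord0 then (sqnorm (offset y) - depth y ^+ 2) / denominator y
   else 2 * depth y * offset y j / denominator y).

Lemma sphere_rowP y : closed_simplex s y -> sphere R d (sphere_row y).
Proof.
move=> sy; have d0 := denominator_gt0 sy; rewrite /sphere /=.
rewrite (bigD1 ord0)//= mxE eqxx.
rewrite (eq_bigr (fun j =>
  (2 * depth y / denominator y) ^+ 2 * offset y j ^+ 2)).
  rewrite -mulr_sumr -/(sqnorm _).
  have : denominator y != 0 by rewrite gt_eqF.
  rewrite /denominator; move: (sqnorm _) (depth y) => q m qm; field.
  exact: qm.
by move=> j /negPf j0; rewrite mxE j0; ring.
Qed.

Definition sphere_map y : sphere R d :=
  insubd (sphere_basepoint R d) (sphere_row y).

Lemma val_sphere_map y :
  closed_simplex s y -> \val (sphere_map y) = sphere_row y.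
Proof. by move=> sy; apply: insubdK; exact/mem_set/sphere_rowP. Qed.

Lemma sphere_row_continuous y : closed_simplex s y ->
  {for y, continuous sphere_row}.
Proof.
move=> sy.
have co j : continuous (fun y => offset y j).
  apply: continuousBfun; last exact: continuous_cstfun.
  exact: coord_ptws_continuous.
have cn : continuous (fun y => sqnorm (offset y)).
  apply: (@continuous_big R _ +%R 0); first exact: add_continuous.
  by move=> j _; apply: continuousMfun; exact: co.
have cm : continuous depth.
  apply: continuousBfun; first exact: continuous_cstfun.
  exact: radius_continuous.
have cm2 : continuous (fun y => depth y ^+ 2) by exact: continuousMfun.
have cd : continuous denominator by exact: continuousDfun.
have d0 : denominator y != 0 by rewrite gt_eqF// denominator_gt0.
have cV : {for y, continuous (fun y => (denominator y)^-1)}.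
  by apply: (@cvgV R {ptws V -> R} (nbhs y) _ denominator); last exact: cd.
apply: continuous_row => j; have [->|/negPf j0] := eqVneq j ord0.
  rewrite (_ : (fun y => _) = (fun y => (sqnorm (offset y) - depth y ^+ 2) *
    (denominator y)^-1)); last by apply/funext => x; rewrite mxE eqxx.
  have c := continuousBfun cn cm2.
  exact: (cvgM (c y) cV).
rewrite (_ : (fun y => _) = (fun y => 2 * depth y * offset y j *
  (denominator y)^-1)); last by apply/funext => x; rewrite mxE j0.
have c2 :=
  continuousMfun (continuousMfun (@continuous_cstfun _ _ (2 : R)) cm) (co j).
exact: (cvgM (c2 y) cV).
Qed.

Lemma sphere_map_continuous :
  {within (closed_simplex s : set {ptws V -> R}), continuous sphere_map}.
Proof.
apply/within_continuous_openP => U [W oW <-].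
have /within_continuous_openP/(_ W oW)[W' oW' WE] :
    {within (closed_simplex s : set {ptws V -> R}), continuous sphere_row}.
  by apply: continuous_in_subspaceT => y /set_mem; exact: sphere_row_continuous.
exists W' => // y sy; rewrite -WE//= /preimage /= .
by rewrite set_valE val_sphere_map.
Qed.

(** With q the square norm and m the depth, the first coordinate (q - m^2)/(q + m^2) is 1 iff m =
    0. *)
Lemma sphere_map_base y : closed_simplex s y ->
  sphere_map y = sphere_basepoint R d <-> radius s y = 1.
Proof.
move=> sy; have d0 := denominator_gt0 sy; split.
  move=> /(congr1 val); rewrite val_sphere_map//= => /rowP/(_ ord0).
  rewrite !mxE !eqxx /= => /(canRL (divfK _)); rewrite gt_eqF// => /(_ isT).
  rewrite mul1r /denominator => h.
  have : depth y ^+ 2 = 0 by lra.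
  by move/eqP; rewrite sqrf_eq0 subr_eq0 => /eqP.
move=> r1; apply: val_inj; rewrite val_sphere_map//=; apply/rowP => j.
rewrite !mxE /=.
have m0 : depth y = 0 by rewrite /depth r1 subrr.
have [_|_] := eqVneq j ord0; last by rewrite m0 mulr0 !mul0r.
move: d0; rewrite /denominator m0 expr0n /= addr0 subr0 => d0.
by rewrite divff ?gt_eqF.
Qed.

Lemma offset_inj y y' : closed_simplex s y -> closed_simplex s y' ->
  offset y =1 offset y' -> y = y'.
Proof.
move=> [_ ys _] [_ ys' _] oo; apply/funext => v.
have [/vertexP[j ->]|vs] := boolP (v \in s); last by rewrite ys// ys'.
by have /addIr := oo j.
Qed.

Lemma radius_offset (l : R) y y' : 0 <= l ->
  (forall j, offset y' j = l * offset y j) -> radius s y' = l * radius s y.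
Proof.
move=> l0 oo; rewrite -gaugeZ//; apply: gauge_ext => v /vertexP[j ->].
exact: oo.
Qed.

(** Let m and m' be the depths and l = m'/m. Equal images force the offset of y' to be l times that
    of y, so both lie on one ray from the barycenter. Radii then scale by l too, and m' = 1 - l (1 -
    m) = 1 - l + m' gives l = 1. *)
Lemma sphere_map_inj y y' : closed_simplex s y -> closed_simplex s y' ->
  radius s y != 1 -> radius s y' != 1 -> sphere_map y = sphere_map y' -> y = y'.
Proof.
move=> sy sy' r1 r1' /(congr1 val); rewrite !val_sphere_map// => /rowP rr.
have d0 := denominator_gt0 sy; have d0' := denominator_gt0 sy'.
have dpos z : closed_simplex s z -> radius s z != 1 -> 0 < depth z.
  move=> sz rz; have [rz1 _ _] := (closed_simplexP s z).1 sz.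
  by rewrite subr_gt0 lt_neqAle rz.
have m0 := dpos _ sy r1; have m0' := dpos _ sy' r1'.
(* The first coordinate equals 1 - 2 m^2 / denominator. *)
have e0 : depth y ^+ 2 / denominator y = depth y' ^+ 2 / denominator y'.
  have := rr ord0; rewrite !mxE !eqxx.
  have E z : closed_simplex s z ->
    (sqnorm (offset z) - depth z ^+ 2) / denominator z =
      1 - 2 * (depth z ^+ 2 / denominator z).
    move=> /denominator_gt0/lt0r_neq0 dz.
    rewrite /denominator in dz *; move: (sqnorm _) (depth z) dz => q m dz.
    by field.
  by rewrite !E// => h; lra.
pose l := depth y' / depth y.
have l0 : 0 <= l by rewrite divr_ge0// ltW.
have oo' j : j != ord0 -> offset y' j = l * offset y j.
  move=> j0; have := rr j; rewrite !mxE (negPf j0) => e1.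
  have dd : denominator y' = denominator y * (depth y' / depth y) ^+ 2.
    have e2 : depth y' ^+ 2 = depth y ^+ 2 / denominator y * denominator y'.
      by rewrite e0 divfK// lt0r_neq0.
    rewrite expr_div_n e2; move: m0 d0.
    move: (depth y) (denominator y) => m D m0 D0.
    by field; rewrite !gt_eqF.
  move: e1; rewrite dd => /esym e1.
  have : offset y' j * (depth y' / (denominator y * (depth y' / depth y) ^+ 2))
    =
      offset y j * (depth y / denominator y) by lra.
  (* The factor is the inverse of the coefficient of [offset y' j]. *)
  move/(congr1 (fun a => a * (denominator y * depth y' / depth y ^+ 2))).
  move: m0 m0' d0; rewrite /l.
  move: (offset y' j) (offset y j) (depth y) (depth y') (denominator y) =>
    a b m m' D.
  move=> m0 m0' D0 h.
  have h1 : a = a * (m' / (D * (m' / m) ^+ 2)) * (D * m' / m ^+ 2).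
    by field; rewrite !gt_eqF.
  by rewrite h1 h; field; rewrite !gt_eqF.
have oo j : offset y' j = l * offset y j.
  (* The dropped coordinate is recovered from the sum being 0. *)
  have [->|/oo'//] := eqVneq j ord0.
  have := sum_offset sy; rewrite (bigD1 ord0)//= => /eqP.
  rewrite addr_eq0 => /eqP ->.
  have := sum_offset sy'; rewrite (bigD1 ord0)//= => /eqP.
  rewrite addr_eq0 => /eqP ->; rewrite mulrN mulr_sumr; congr (- _).
  by apply: eq_bigr => i /oo'.
have l1 : l = 1.
  have rl := radius_offset l0 oo.
  have : depth y' = 1 - l * (1 - depth y).
    by rewrite /depth rl opprB [1 + (_ - 1)]addrC subrK.
  have -> : l * (1 - depth y) = l - depth y'.
    by rewrite mulrBr mulr1 /l divfK// gt_eqF.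
  lra.
by apply: offset_inj => // j; rewrite oo l1 mul1r.
Qed.

(** The preimage is explicit: project stereographically from the basepoint to a vector z of the
    hyperplane, then shrink z into the open simplex. *)
Lemma sphere_map_surj (p : sphere R d) : p <> sphere_basepoint R d ->
  exists2 y : {ptws V -> R}, closed_simplex s y & sphere_map y = p.
Proof.
case: p => w wS0 wb; have := set_mem wS0; rewrite /sphere /= => wS.
have wQ : sqnorm (w ord0) = 1 - w ord0 ord0 ^+ 2.
  by rewrite -wS [in RHS](bigD1 ord0)//= addrC addrK.
have c1 : w ord0 ord0 < 1.
  have c2 : w ord0 ord0 ^+ 2 <= 1 by have := sqnorm_ge0 (w ord0); rewrite wQ;
    lra.
  rewrite lt_neqAle; apply/andP; split; last by nra.
  apply/eqP => c1; apply: wb; apply: val_inj => /=.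
  have /eqP : sqnorm (w ord0) = 0 by rewrite wQ c1; ring.
  rewrite psumr_eq0 => [/allP w0|j _]; last exact: sqr_ge0.
  apply/rowP => j; rewrite !mxE /=.
  have [->//|j0] := eqVneq j ord0.
  by have := w0 j (mem_index_enum _); rewrite j0 /= sqrf_eq0 => /eqP.
clear wb; set c := w ord0 ord0 in wQ c1.
pose z' (j : 'I_d.+1) := w ord0 j / (1 - c).
pose z (j : 'I_d.+1) := if j == ord0 then - \sum_(i | i != ord0) z' i else z' j.
have z0 : \sum_j z j = 0.
  rewrite (bigD1 ord0)//= {1}/z eqxx addrC; apply/eqP; rewrite subr_eq0;
    apply/eqP.
  by apply: eq_bigr => j /negPf j0; rewrite /z j0.
have zQ : sqnorm z = (1 + c) / (1 - c).
  rewrite /sqnorm (eq_bigr (fun j => (1 - c)^-1 ^+ 2 * w ord0 j ^+ 2));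
    last first.
    by move=> j /negPf j0; rewrite /z j0 /z'; ring.
  by rewrite -mulr_sumr -/(sqnorm (w ord0)) wQ; field; lra.
pose zV v : R := if v \in s then z (inord (index v s)) else 0.
have zVE j : zV (vertex j) = z j.
  have js : (j < #|` s|)%N by rewrite card_s.
  by rewrite /zV vertex_in /vertex index_uniq ?inord_val ?fset_uniq.
(* The solution of 1 - l * gauge = l: the point with offset l * z then has depth l, so offset
   divided by depth is z. *)
pose l := (1 + gauge s zV)^-1.
have g0 := gauge_ge0 s zV.
have l0 : 0 < l by rewrite invr_gt0; lra.
pose y (v : V) : R := barycenter R s v + l * zV v.
have oy j : offset y j = l * z j by rewrite /offset /y addrC addKr zVE.
have ry : radius s y = l * gauge s zV.
  by rewrite -gaugeZ ?ltW//; apply: gauge_ext => v _; rewrite /y addrC addKr.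
have my : depth y = l.
  by rewrite /depth ry /l; field; lra.
have s0 : s != fset0 by rewrite -cardfs_gt0 card_s.
have sy : closed_simplex s y.
  apply/closed_simplexP; split.
  - by rewrite ry /l mulrC ler_pdivrMr ?mul1r; lra.
  - by move=> v /negPf vs; rewrite /y /barycenter /zV vs mulr0 addr0.
  - rewrite big_split /= sum_barycenter// -mulr_sumr sum_vertex.
    by rewrite (eq_bigr z) ?z0 ?mulr0 ?addr0// => j _; rewrite zVE.
exists y => //; apply: val_inj; rewrite val_sphere_map//=.
have Qy : sqnorm (offset y) = l ^+ 2 * ((1 + c) / (1 - c)).
  rewrite -zQ mulr_sumr; apply: eq_bigr => j _; rewrite oy; ring.
have l00 : l != 0 by rewrite gt_eqF.
have nz : (1 - c != 0) && (l ^+ 2 * (1 + c) + l ^+ 2 * (1 - c) != 0).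
  rewrite (_ : _ + _ = l ^+ 2 * 2); last by ring.
  rewrite mulf_neq0 ?expf_neq0 ?pnatr_eq0// andbT.
  by apply/eqP => h; lra.
apply/rowP => j; rewrite mxE /denominator Qy my oy.
have [->|j0] := eqVneq j ord0.
  by rewrite -/c; field.
by rewrite /z (negPf j0) /z'; field.
Qed.

End SphereMap.

(** * From the complex to the bouquet *)

Lemma inj_continuous_hausdorff (X Y : topologicalType) (f : X -> Y) :
  injective f -> continuous f -> hausdorff_space Y -> hausdorff_space X.
Proof.
move=> fI cf hY p q pq; apply/fI/hY => A B /cf fA /cf fB.
by have [x [/= Ax Bx]] := pq _ _ fA fB; exists (f x).
Qed.

Lemma sphere_hausdorff (R : realType) d : hausdorff_space (sphere R d).
Proof.
apply: (@inj_continuous_hausdorff _ 'rV[R]_d.+1 set_val).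
- exact: val_inj.
- exact: initial_continuous.
- exact: (@norm_hausdorff R 'rV[R]_d.+1).
Qed.

Section Wedge.
Variables (I : choiceType) (X : I -> topologicalType) (p0 : forall i, X i).

(** [wedge_prod] sends the lift of a to the family with a at index i and basepoints elsewhere, from
    which a can be read off. *)
Lemma wedge_lift_inj i (a b : X i) :
  wedge_lift p0 a = wedge_lift p0 b -> a = b.
Proof.
move=> /(congr1 (@wedge_prod _ _ p0)).
rewrite /wedge_prod !wedge_lift_funE; try exact: wedge_prod_pointE.
by move=> /(congr1 (fun f => f i)); rewrite !dfwithin.
Qed.

Lemma wedge_lift_neq i j (a : X i) (b : X j) :
  wedge_lift p0 a = wedge_lift p0 b -> i != j -> a = p0 i.
Proof.
move=> /(congr1 (@wedge_prod _ _ p0)).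
rewrite /wedge_prod !wedge_lift_funE; try exact: wedge_prod_pointE.
move=> /(congr1 (fun f => f i)) + ij.
by rewrite dfwithin dfwithout // eq_sym.
Qed.

End Wedge.

Section Bouquet.
Variables (R : realType) (V : choiceType) (d : nat) (C D : set {fset V}).
Hypothesis cD : simplicial_complex D.
Hypothesis DC : D `<=` C.
Hypothesis properD : forall s t, C s -> t != fset0 ->
  (t `<=` s)%fset -> t != s -> D t.
Variables (I : choiceType) (i0 : I) (e : I -> {fset V}) (v0 : V).
Hypothesis e_inj : injective e.
Hypothesis eC : forall i, C (e i).
Hypothesis eD : forall i, ~ D (e i).
Hypothesis e_surj : forall s, C s -> ~ D s -> exists i, e i = s.
Hypothesis card_e : forall i, #|` e i| = d.+1.

Let B : topologicalType := bouquet R d I.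
Let base : sphere R d := sphere_basepoint R d.
Let lift (i : I) (a : sphere R d) : B :=
  @wedge_lift I (fun=> sphere R d : topologicalType) (fun=> base) i a.
Let pmap (i : I) (y : {ptws V -> R}) : sphere R d := sphere_map d (e i) v0 y.

Let lift_base i j : lift i base = lift j base.
Proof.
exact: (@wedge_liftE I (fun=> sphere R d : topologicalType) (fun=> base)
  j base i base).
Qed.

Let lift_eq i j a b : a <> base -> lift i a = lift j b -> i = j /\ a = b.
Proof.
move=> ab ij; have [ij'|ij'] := eqVneq i j.
  by split=> //; move: ij; rewrite ij'; exact: wedge_lift_inj.
by case: ab; exact: (wedge_lift_neq ij).
Qed.

Let lift_continuous i : continuous (lift i).
Proof.
exact: (@wedge_lift_continuous I (fun=> sphere R d : topologicalType)
  (fun=> base) i).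
Qed.

Let index : {I' : {fset V} -> I | forall i, I' (e i) = i}.
Proof.
have h s : exists i, (exists j, e j = s) -> e i = s.
  by have [[i ei]|ne] := pselect (exists i, e i = s); [exists i|exists i0].
apply: cid; have [f fP] := choice h.
by exists f => i; apply: e_inj; apply: fP; exists i.
Qed.

Let simplex_of (x : realization R C) : {fset V} := sval (cid2 (coordsP x)).

(** The index [i0] on |D| is immaterial, because [lift_base] identifies all basepoints. *)
Definition collapse (x : realization R C) : B :=
  if pselect (realization_sub D x) then lift i0 base
  else lift (sval index (simplex_of x))
    (pmap (sval index (simplex_of x)) (coords x)).

Lemma collapse_sub x : realization_sub D x -> collapse x = lift i0 base.
Proof. by rewrite /collapse; case: pselect. Qed.

Variable c0 : realization R C.

Lemma pmap_boundary i y :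
  closed_simplex (e i) y -> realization_sub D (realize c0 y) ->
  pmap i y = base.
Proof.
move=> iy yD; apply/(sphere_map_base _ (card_e i) iy)/eqP;
  apply/negPn/negP => r1.
by have := @interior_sub _ _ C D cD _ (realize c0 y) (eC i) (@eD i);
  rewrite (realizeK _ (eC i)) // => /(_ iy r1).
Qed.

Lemma collapse_simplex i y : closed_simplex (e i) y ->
  collapse (realize c0 y) = lift i (pmap i y).
Proof.
move=> iy; rewrite /collapse; case: pselect => [yD|yD] /=.
  by rewrite pmap_boundary.
have cy : coords (realize c0 y) = y by rewrite (realizeK _ (eC i)).
have r1 : radius (e i) y != 1.
  apply/eqP => r1; have [v [_ Dv vy]] := boundary_sub properD (eC i) iy r1.
  by apply: yD; exists (e i `\ v)%fset; rewrite ?cy.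
suff -> : simplex_of (realize c0 y) = e i by rewrite (svalP index) cy.
rewrite /simplex_of; case: cid2 => s' /= Cs'; rewrite cy => s'y.
exact: (interior_unique properD (eC i) (@eD i) iy r1).
Qed.

Lemma simplex_cases x : realization_sub D x \/
  exists i y, [/\ closed_simplex (e i) y,
    radius (e i) y != 1 & x = realize c0 y].
Proof.
have [xD|xD] := pselect (realization_sub D x); [by left|right].
have [s Cs sx] := coordsP x.
have [|i ei] := @e_surj s Cs; first by move=> Ds; apply: xD; exists s.
exists i, (coords x); rewrite ei coordsK; split=> //.
apply/eqP => r1; have [v [_ Dv vy]] := boundary_sub properD Cs sx r1.
by apply: xD; exists (s `\ v)%fset.
Qed.

Lemma collapse_continuous : continuous collapse.
Proof.
apply: (@continuous_realization _ _ _ c0) => s Cs.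
have [Ds|Ds] := pselect (D s).
  apply: (@within_eq _ _ _ (fun=> lift i0 base)).
    by move=> y sy; rewrite /= collapse_sub//; exists s;
      rewrite ?(realizeK _ Cs).
  by apply: continuous_subspaceT; exact: continuous_cstfun.
have [i ei] := e_surj Cs Ds; rewrite -ei.
apply: (@within_eq _ _ _ (lift i \o pmap i)).
  by move=> y sy; exact: (esym (collapse_simplex sy)).
apply: (within_comp (B := setT)) => //.
  exact: sphere_map_continuous.
by apply: continuous_subspaceT; exact: lift_continuous.
Qed.

(** Openness is tested on each sphere. Apart from the basepoint, the complement of U there is the
    image of a compact part of the simplex, hence closed because spheres are Hausdorff. *)
Lemma collapse_open U : open (collapse @^-1` U) -> open U.
Proof.
move=> oU; apply/wedge_openP => i.
have /within_continuous_openP := @realize_continuous R V C c0 (e i) (eC i).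
move=> /(_ _ oU)[W oW WE].
set Ui : set (sphere R d) := _ @^-1` U.
have UE y : closed_simplex (e i) y -> Ui (pmap i y) <-> W y.
  by move=> iy; rewrite -WE// /preimage /= (collapse_simplex iy).
pose K : set {ptws V -> R} := closed_simplex (e i) `&` ~` W.
have cK : compact K.
  by apply: compact_closedI;
    [exact: compact_closed_simplex|exact: open_closedC].
have hS := @sphere_hausdorff R d.
have clK : closed (pmap i @` K).
  apply: compact_closed => //; apply: continuous_compact => //.
  apply: (@continuous_subspaceW _ _ K
    (closed_simplex (e i) : set {ptws V -> R})).
    by move=> y [].
  exact: sphere_map_continuous.
rewrite -[Ui]setCK; apply: closed_openC.
(* The basepoint is treated separately: for d = 0 it is not in the image of the simplex. *)
have [Ub|Ub] := pselect (Ui base).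
  suff -> : ~` Ui = pmap i @` K by [].
  apply/seteqP; split=> [a Ua|_ [y [iy nW] <-]]; last by move=> /(UE _ iy).
  have [|y iy ya] := @sphere_map_surj R V d (e i) v0 (card_e i) a.
    by move=> ab; apply: Ua; rewrite ab.
  exists y => //; split=> // Wy; apply: Ua; rewrite -ya.
  exact/UE.
suff -> : ~` Ui = pmap i @` K `|` [set base].
  by apply: closedU => //; apply/accessible_closed_set1/hausdorff_accessible.
apply/seteqP; split=> [a Ua|a [[y [iy nW] <-]|->//]]; last by move=> /(UE _ iy).
have [->|/eqP ab] := eqVneq a base; [by right|left].
have [y iy ya] := @sphere_map_surj R V d (e i) v0 (card_e i) a ab.
exists y => //; split=> // Wy; apply: Ua; rewrite -ya.
exact/UE.
Qed.

Lemma homotopy_equivalent_bouquet : contractible R (realization R D) ->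
  homotopy_equivalent R (realization R C) B.
Proof.
move=> [a [h [ch h0 h1]]].
have [G [cG G0 GD]] := @homotopy_extension R V C D cD DC properD a h ch h0.
have subE (x : realization R C) :
  realization_sub D x -> exists x', x = inclusion DC x'.
  move=> [s Ds sx]; exists (realize a (coords x)).
  by apply: coords_inj; rewrite /= (realizeK _ Ds).
have inclD x : realization_sub D (inclusion DC x) by exact: coordsP x.
have pneq i y : closed_simplex (e i) y -> radius (e i) y != 1 ->
  pmap i y <> base.
  by move=> iy r1 /(sphere_map_base v0 (card_e i) iy) r1';
    rewrite r1' eqxx in r1.
apply: (@homotopy_equivalent_collapse R _ _ (realization_sub D) collapse G) =>
  //.
- exact: collapse_continuous.
- move=> b; have : [set: B] b by [].
  rewrite /B /bouquet -wedgeTE => -[i _ [p _ <-]].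
  have [->|/eqP pb] := eqVneq p base.
    (* The basepoint is the image of |D|, which contains a. *)
    exists (inclusion DC a); rewrite collapse_sub//; exact: lift_base.
  have [y iy <-] := @sphere_map_surj R V d (e i) v0 (card_e i) p pb.
  by exists (realize c0 y); rewrite (collapse_simplex iy).
- exact: collapse_open.
- by move=> x x' xD xD'; rewrite !collapse_sub.
- move=> x x'; have [xD|[i [y [iy r1 ->]]]] := simplex_cases x;
    have [xD'|[j [y' [jy' r1' ->]]]] := simplex_cases x'.
  + by right.
  + rewrite collapse_sub// (collapse_simplex jy') =>
      /esym/(lift_eq (pneq _ _ jy' r1'))[_ pb].
    by have := pneq _ _ jy' r1'; rewrite pb.
  + rewrite (collapse_simplex iy) collapse_sub// =>
      /(lift_eq (pneq _ _ iy r1))[_ pb].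
    by have := pneq _ _ iy r1; rewrite pb.
  + rewrite (collapse_simplex iy) (collapse_simplex jy') =>
      /(lift_eq (pneq _ _ iy r1))[ij].
    rewrite -{}ij in jy' r1' *;
      move=> /(sphere_map_inj (card_e i) iy jy' r1 r1').
    by move=> ->; left.
- by move=> x t /subE[x' ->] _; rewrite GD; exact: inclD.
- by move=> x x' /subE[y ->] /subE[y' ->]; rewrite !GD !h1.
Qed.

End Bouquet.

(** * Counting facets *)

(* The vector space dimension of MathComp shadows the dimension of simplices. *)
Local Notation dim := Defs.dim.

Section Counting.
Variable V : choiceType.
Implicit Types (s t : {fset V}) (A B : {fset {fset V}}) (C D E : set {fset V}).

(** Double counting of the incident pairs (s, t). *)
Lemma sum_subset_count A B :
  (\sum_(s <- A) #|` [fset t in B | (s `<=` t)%fset]%fset| =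
   \sum_(t <- B) #|` [fset s in A | (s `<=` t)%fset]%fset|)%N.
Proof.
under eq_bigr do rewrite card_fset_sum1 -big_fset_condE.
under [RHS]eq_bigr do rewrite card_fset_sum1 -big_fset_condE.
exact: exchange_big_dep.
Qed.

Lemma card_facet d t v : #|` t| = d.+1 -> v \in t -> #|` (t `\ v)%fset| = d.
Proof. by move=> td vt; apply/eqP; rewrite -eqSS -td (cardfsD1 v t) vt. Qed.

(** A d-element subset of t omits exactly one vertex, so the members of A inside t correspond to the
    vertices of t. *)
Lemma card_facets d t A : #|` t| = d.+1 -> (forall s, s \in A -> #|` s| = d) ->
  (forall v, v \in t -> (t `\ v)%fset \in A) ->
  #|` [fset s in A | (s `<=` t)%fset]%fset| = d.+1.
Proof.
move=> td Ad tA.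
suff -> : [fset s in A | (s `<=` t)%fset]%fset =
    [fset (t `\ v)%fset | v in t]%fset.
  rewrite card_in_imfset//= => v w vt wt vw.
  apply: contra_eq vw => vw; apply/eqP => /fsetP/(_ v).
  by rewrite !in_fsetD1 eqxx vw vt.
apply/fsetP => s; rewrite !inE; apply/andP/imfsetP => [[sA st]|[v /= vt ->]].
  have /fset0Pn[v] : (t `\` s)%fset != fset0.
    rewrite -cardfs_gt0 cardfsD (fsetIidPr st) td Ad//.
    by rewrite subSn// subnn.
  rewrite in_fsetD => /andP[vs vt]; exists v => //.
  apply/eqP; rewrite eqEfcard fsubsetD1 st vs /= (Ad s)//.
  by rewrite (card_facet td).
by split; [exact: tA|exact: fsubD1set].
Qed.

Lemma degreeE E s B : (forall t, cofaces E s t <-> t \in B) ->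
  degree E s = #|` B|.
Proof.
move=> EB; rewrite /degree (_ : cofaces E s = [set` B]) ?set_fsetK//.
by apply/seteqP; split=> t /= /EB.
Qed.

Lemma card_dim d C s : simplicial_complex C -> (0 < d)%N -> F d.-1 C s ->
  #|` s| = d.
Proof.
move=> [C0 _] d0 [Cs]; rewrite /dim => sd.
by rewrite -(prednK d0) -sd prednK// cardfs_gt0 C0.
Qed.

(** The nonempty faces of members of E form a complex, so t is a face of some u in E; as dim u <= d
    = dim t, the two coincide. *)
Lemma generated_top D E d t : (forall s, E s -> (dim s <= d)%N) ->
  E `<=` D -> simplicial_complex D ->
  generated E t -> dim t = d -> E t.
Proof.
move=> Ed ED cD gt td.
pose M : set {fset V} :=
  [set s | s != fset0 /\ exists2 u, E u & (s `<=` u)%fset].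
have cM : simplicial_complex M.
  split=> [s []//|s u [s0 [w Ew sw]] u0 us]; split=> //.
  by exists w => //; exact: fsubset_trans sw.
have EM : E `<=` M.
  by move=> s Es /=; split; [exact: (cD.1 _ (ED _ Es))|exists s].
have [t0 [u Eu tu]] : M t by exact: (gt M (conj cM EM)).
suff -> : t = u by [].
apply/eqP; rewrite eqEfcard tu /=.
have := Ed _ Eu; rewrite /dim -td /dim.
have : (0 < #|` t|)%N by rewrite cardfs_gt0.
by case: #|` t| => // k _ /=; case: #|` u|.
Qed.

End Counting.

(** * Degree sums over a finite subcomplex of a regular complex *)

Section RegularCount.
Variables (V : choiceType) (d n : nat) (C D D' : set {fset V}).
Hypotheses (d0 : (0 < d)%N) (cC : simplicial_complex C)
  (dimC : forall s, C s -> (dim s <= d)%N)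
  (cD : simplicial_complex D) (DC : D `<=` C)
  (regC : regular d n C)
  (cD' : simplicial_complex D') (DD' : D' `<=` D) (finD' : finite_set D').

Let A : {fset {fset V}} := fset_set (F d.-1 D').

Let finF k : finite_set (F k D').
Proof. by apply: sub_finite_set finD' => s []. Qed.

Let AP s : s \in A <-> F d.-1 D' s.
Proof. by rewrite /A in_fset_set// inE. Qed.

Let A_card s : s \in A -> #|` s| = d.
Proof. by move=> /AP; exact: card_dim. Qed.

Let A_dim s : s \in A -> (dim s).+1 = d.
Proof. by move=> /AP[_ ->]; rewrite prednK. Qed.

Let A_cofaces_finite s : s \in A -> finite_set (cofaces C s).
Proof.
move=> /AP[D's sd]; apply/finite_setP; exists n; apply: regC; split=> //.
exact/DC/DD'.
Qed.

(** The n cofaces of s in C are sorted into those in D', in D - D' and off D. By [generated_top],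
    generating a complex from D - D' adds no d-simplices, so the middle term counts correctly. *)
Lemma degree_split s : s \in A -> n = (degree D' s +
  degree (generated (D `\` D')) s + degree (C `\` D) s)%N.
Proof.
(* Regularity makes all these coface sets finite, so [fset_set] never takes its default value. *)
move=> sA; have fC := A_cofaces_finite sA.
have fsub E : E `<=` C -> finite_set (cofaces E s).
  by move=> EC; apply: sub_finite_set fC => t [[/EC Ct td] st].
have <- : #|` fset_set (cofaces C s)| = n.
  apply: card_fset_set; apply: regC; have /AP[D's sd] := sA; split=> //.
  exact/DC/DD'.
have gE : cofaces (generated (D `\` D')) s = cofaces (D `\` D') s.
  apply/seteqP; split=> t [[gt td] st]; split=> //; split=> //.
    apply: (@generated_top _ D (D `\` D') d t) => //.
    - by move=> u [/DC/dimC].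
    - exact: etrans td (A_dim sA).
  exact: sub_smallest gt.
have f1 := fsub D' (subset_trans DD' DC).
have f2 : finite_set (cofaces (D `\` D') s).
  by apply: fsub => t [/DC].
have f3 : finite_set (cofaces (C `\` D) s) by apply: fsub => t [].
rewrite /degree gE.
have -> : cofaces C s =
    cofaces D' s `|` cofaces (D `\` D') s `|` cofaces (C `\` D) s.
  apply/seteqP; split=> t.
    move=> [[Ct td] st]; have [Dt|Dt] := pselect (D t); last by right.
    by left; have [D't|D't] := pselect (D' t); [left|right].
  move=> [[|]|] [[]].
  - by move=> /DD'/DC Ct td st.
  - by move=> [/DC Ct _] td st.
  - by move=> [Ct _] td st.
rewrite fset_setU ?finite_setU// fset_setU//.
have disj (X Y : set {fset V}) :
  finite_set X -> finite_set Y -> X `&` Y = set0 ->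
    #|` (fset_set X `|` fset_set Y)%fset| =
    (#|` fset_set X| + #|` fset_set Y|)%N.
  by move=> fX fY XY; rewrite -cardfsUI -fset_setI// XY fset_set0 cardfs0 addn0.
rewrite -fset_setU// disj ?finite_setU//.
  rewrite fset_setU// disj//.
  by apply/seteqP; split=> // t [[[D't _] _] [[[_ nD't] _] _]].
apply/seteqP; split=> // t [[[[/DD' Dt _] _]|[[[Dt _] _] _]] [[[_ nDt] _] _]]
  //.
Qed.

(** Each d-simplex of D' has d+1 facets, all of them in D'. *)
Lemma sum_degree_sub : (\sum_(s <- A) degree D' s = d.+1 * beta d D')%N.
Proof.
pose B := fset_set (F d D').
have BP t : t \in B <-> F d D' t by rewrite /B in_fset_set// inE.
rewrite (eq_big_seq (fun s => #|` [fset t in B | (s `<=` t)%fset]%fset|)).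
  rewrite sum_subset_count (eq_big_seq (fun=> d.+1)).
    by rewrite big_const_seq count_predT iter_addn_0.
  move=> t /BP[D't td].
  have tc : #|` t| = d.+1.
    by move: td; rewrite /dim => <-; rewrite prednK// cardfs_gt0;
      exact: cD'.1 D't.
  apply: card_facets => // v vt; apply/AP.
  have tvc := card_facet tc vt.
  split; last by rewrite /dim tvc.
  apply: (cD'.2 t) => //; last exact: fsubD1set.
  by rewrite -cardfs_gt0 tvc.
move=> s sA; apply: degreeE => t; rewrite /cofaces (A_dim sA) !inE.
split=> [[Ft st]|/andP[/BP Ft st]]; last by split.
by rewrite st andbT; apply/BP.
Qed.

(** A simplex of D' off the boundary has degree 0: a coface in the generated complex would bring its
    face along. *)
Lemma sum_degree_boundary :
  total_degree (generated (D `\` D')) (F d.-1 (boundary D D')) =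
  (\sum_(s <- A) degree (generated (D `\` D')) s)%N.
Proof.
rewrite /total_degree fsbig_finite; last first.
  by apply: sub_finite_set finD' => s [[]].
set A' := fset_set _.
have A'P s : s \in A' <-> F d.-1 (boundary D D') s.
  by rewrite /A' in_fset_set ?inE//; apply: sub_finite_set finD' => u [[]].
apply: big_fset_incl.
  by apply/fsubsetP => s /A'P[[D's _] sd]; apply/AP.
move=> s /AP[D's sd] sA'; rewrite (degreeE (B := fset0)) ?cardfs0// => t.
split=> // -[[gt _] st]; case/negP: sA'; apply/A'P; split=> //;
  split=> // Y [cY EY].
have Yt : Y t by exact: (gt Y (conj cY EY)).
by apply: (cY.2 t) => //; exact: (cD'.1 s).
Qed.

(** The sum of [degree_split] over the (d-1)-simplices of D', kept additive to avoid truncated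
    subtraction. *)
Lemma formula_count :
  (n * beta d.-1 D' = d.+1 * beta d D' +
   total_degree (generated (D `\` D')) (F d.-1 (boundary D D')) +
   \sum_(s <- A) degree (C `\` D) s)%N.
Proof.
rewrite sum_degree_boundary -sum_degree_sub -!big_split /=.
transitivity (\sum_(s <- A) n)%N.
  by rewrite big_const_seq count_predT iter_addn_0.
by apply: eq_big_seq => s /degree_split.
Qed.

(** Only pairs whose upper member lies in B are counted, which makes sense even if infinitely many
    simplices are missing. *)
Lemma sum_degree_ge (B : {fset {fset V}}) : [set` B] `<=` C `\` D ->
  (forall t, t \in B -> dim t = d) ->
  (forall t v, t \in B -> v \in t -> D' (t `\ v)%fset) ->
  (d.+1 * #|` B| <= \sum_(s <- A) degree (C `\` D) s)%N.
Proof.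
move=> BT Bd BD'.
apply: (@leq_trans (\sum_(s <- A) #|` [fset t in B | (s `<=` t)%fset]%fset|)%N).
  rewrite sum_subset_count (eq_big_seq (fun=> d.+1)).
    by rewrite big_const_seq count_predT iter_addn_0 mulnC.
  move=> t tB.
  have tc : #|` t| = d.+1.
    rewrite -(Bd _ tB) /dim prednK// cardfs_gt0.
    by have [Ct _] := BT _ tB; exact: cC.1 Ct.
  apply: card_facets => // v vt; apply/AP; split; first exact: BD'.
  by rewrite /dim (card_facet tc).
rewrite big_seq [leqRHS]big_seq; apply: leq_sum => s sA.
apply: fsubset_leq_card; apply/fsubsetP => t; rewrite !inE => /andP[tB st].
rewrite in_fset_set; last first.
  by apply: sub_finite_set (A_cofaces_finite sA) => u [[[Cu _] ud] su].
by rewrite inE; split=> //; split; [exact: BT|rewrite (A_dim sA) Bd].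
Qed.

Lemma sum_degree_le (B : {fset {fset V}}) : [set` B] = C `\` D ->
  (forall t, t \in B -> dim t = d) ->
  (\sum_(s <- A) degree (C `\` D) s <= d.+1 * #|` B|)%N.
Proof.
move=> BT Bd.
rewrite (eq_big_seq (fun s => #|` [fset t in B | (s `<=` t)%fset]%fset|));
  last first.
  move=> s sA; apply: degreeE => t; rewrite /cofaces /F -BT (A_dim sA) !inE /=.
  by split=> [[[-> _] ->]//|/andP[tB st]]; split=> //; split=> //; exact: Bd.
rewrite sum_subset_count -[leqRHS]mulnC.
apply: (@leq_trans (\sum_(t <- B) d.+1)%N); last first.
  by rewrite big_const_seq count_predT iter_addn_0 mulnC.
rewrite big_seq [leqRHS]big_seq; apply: leq_sum => t tB.
have [Ct _] : (C `\` D) t by rewrite -BT.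
have tc : #|` t| = d.+1 by rewrite -(Bd _ tB) /dim prednK// cardfs_gt0;
  exact: cC.1 Ct.
(* Enlarging A by all the facets of t makes the count exactly d+1. *)
rewrite -(@card_facets _ d t (A `|` [fset (t `\ v)%fset | v in t])%fset tc).
- apply: fsubset_leq_card; apply/fsubsetP => s; rewrite !inE => /andP[sA ->].
  by rewrite sA.
- move=> s; rewrite in_fsetU => /orP[/A_card//|/imfsetP[v /= vt ->]].
  exact: card_facet tc vt.
- by move=> v vt; rewrite in_fsetU; apply/orP; right; apply: in_imfset.
Qed.

End RegularCount.

(** * The number of spheres *)

Lemma liminf_near (V : choiceType) (D : set {fset V}) (Di : nat -> set {fset V})
    (s : {fset V}) : is_liminf D Di -> D s -> \forall i \near \oo, Di i s.
Proof.
move=> lim Ds; have : F (dim s) D s by [].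
rewrite lim => -[i _ h]; exists i => // j ij.
by have [] := h j ij.
Qed.

(** Only finitely many facets occur, so they are eventually all present at once. *)
Lemma near_facets (V : choiceType) (C D : set {fset V})
    (Di : nat -> set {fset V}) (B : {fset {fset V}}) :
  is_liminf D Di -> (forall t v, t \in B -> v \in t -> D (t `\ v)%fset) ->
  \forall i \near \oo, forall t v, t \in B -> v \in t -> Di i (t `\ v)%fset.
Proof.
move=> lim BD.
pose P t := \bigcap_(v in [set` t]) [set i | Di i (t `\ v)%fset].
have H : \oo (\bigcap_(t in [set` B]) P t).
  apply: filter_bigI => t tB; apply: filter_bigI => v vt.
  by apply: liminf_near lim _; exact: BD.
by apply: filterS H => i h t v tB vt; exact: h.
Qed.

Section Assembly.
Variables (R : realType) (V : choiceType) (d : nat) (C D : set {fset V}).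
Hypotheses (hC : simplicial_complex C) (dimC : has_dimension C d)
  (spanD : spanning_subcomplex d C D).

Let cD : simplicial_complex D. Proof. by case: spanD. Qed.
Let DC : D `<=` C. Proof. by case: spanD. Qed.

Let dim_le s : C s -> (dim s <= d)%N. Proof. by case: dimC => _; exact. Qed.

Lemma dim_missing t : (C `\` D) t -> dim t = d.
Proof.
case: spanD => _ _ skel _ [Ct Dt]; apply/eqP; rewrite eqn_leq dim_le//= leqNgt.
by apply/negP => td; apply: Dt; exact: skel.
Qed.

Lemma card_missing t : (C `\` D) t -> #|` t| = d.+1.
Proof.
move=> tT; rewrite -(dim_missing tT) /dim prednK// cardfs_gt0.
by have [Ct _] := tT; exact: hC.1 Ct.
Qed.

(** A proper face has dimension less than d, hence lies in the skeleton contained in D. *)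
Lemma proper_face_sub s t :
  C s -> t != fset0 -> (t `<=` s)%fset -> t != s -> D t.
Proof.
case: spanD => _ _ skel _ Cs t0 ts tns; apply: skel; first exact: hC.2 ts.
apply: leq_trans (dim_le Cs); rewrite /dim.
have : (#|` t| < #|` s|)%N by apply: fproper_ltn_card; rewrite fproperEneq tns.
have : (0 < #|` t|)%N by rewrite cardfs_gt0.
by case: #|` t| => // k _; case: #|` s|.
Qed.

Lemma facet_missing t v :
  (0 < d)%N -> (C `\` D) t -> v \in t -> D (t `\ v)%fset.
Proof.
move=> d0 tT vt; apply: (@proper_face_sub t); first by case: tT.
- by rewrite -cardfs_gt0 (card_facet (card_missing tT)).
- exact: fsubD1set.
- by apply: contraTneq vt => <-; rewrite in_fsetD1 eqxx.
Qed.

Lemma homotopy_equivalent_indexed (I : choiceType) (i0 : I)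
    (e : I -> {fset V}) : contractible R (realization R D) -> injective e ->
  (forall i, (C `\` D) (e i)) -> (forall s, (C `\` D) s -> exists i, e i = s) ->
  homotopy_equivalent R (realization R C) (bouquet R d I).
Proof.
move=> ctr eI eT eS; have [a _] := ctr.
have /fset0Pn[v0 _] :
  e i0 != fset0 by rewrite -cardfs_gt0 (card_missing (eT i0)).
apply: (@homotopy_equivalent_bouquet R V d C D cD DC _ I i0 e v0) => //.
- exact: proper_face_sub.
- by move=> i; case: (eT i).
- by move=> i; case: (eT i).
- by move=> s Cs Ds; exact: eS.
- by move=> i; exact: card_missing.
- exact: (inclusion DC a).
Qed.

Lemma homotopy_equivalent_finite : contractible R (realization R D) ->
  finite_set (C `\` D) ->
  homotopy_equivalent_to_bouquet R (realization R C) d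
    (Some #|` fset_set (C `\` D)|).
Proof.
move=> ctr fT; set B := fset_set _.
have BP t : t \in B <-> (C `\` D) t by rewrite /B in_fset_set// inE.
case Bk : #|` B| => [|k] /=.
  (* Without missing simplices the claim is contractibility, which |C| = |D| has by assumption. *)
  suff -> : C = D by [].
  apply/seteqP; split=> // s Cs; apply: contrapT => Ds.
  have : s \in B by exact/BP.
  by rewrite (cardfs0_eq Bk).
apply: (@homotopy_equivalent_indexed 'I_k.+1 ord0 (fun i => nth fset0 B i)) =>
  //.
- move=> i j /eqP; rewrite nth_uniq ?fset_uniq ?Bk// => /eqP; exact: val_inj.
- by move=> i; apply/BP/mem_nth; rewrite Bk.
- move=> s /BP sB.
  have si : (index s B < k.+1)%N by rewrite -Bk index_mem.
  by exists (Ordinal si); rewrite /= nth_index.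
Qed.

Lemma homotopy_equivalent_infinite : contractible R (realization R D) ->
  countable C -> infinite_set (C `\` D) ->
  homotopy_equivalent_to_bouquet R (realization R C) d None.
Proof.
move=> ctr cC iT.
have cT : countable (C `\` D) by apply: sub_countable cC;
  apply: subset_card_le => s [].
have /card_set_bijP[f [_ fI fS]] := eq_card_nat cT iT.
have fS' i : exists s, (C `\` D) s /\ f s = i.
  by have [s Ts fs] := fS i Logic.I; exists s.
have [e eP] := choice fS'.
apply: (@homotopy_equivalent_indexed nat 0%N e) => //.
- by move=> i j ij; rewrite -(eP i).2 ij (eP j).2.
- by move=> i; case: (eP i).
- move=> s Ts; exists (f s); apply: fI; rewrite ?inE//;
    first by case: (eP (f s)).
  by case: (eP (f s)).
Qed.

Variables (n : nat) (Di : nat -> set {fset V}).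
Hypotheses (d0 : (0 < d)%N) (regC : regular d n C)
  (subDi : forall i, subcomplex (Di i) D /\ finite_set (Di i))
  (limD : is_liminf D Di).

Let missing_degree i : nat :=
  \sum_(s <- fset_set (F d.-1 (Di i))) degree (C `\` D) s.

Lemma sequence_count i : d.+1%:R^-1 *
    (n%:R * (beta d.-1 (Di i))%:R -
     (total_degree (generated (D `\` Di i)) (F d.-1 (boundary D (Di i))))%:R)
    - (beta d (Di i))%:R = (missing_degree i)%:R / d.+1%:R :> R.
Proof.
have [[cDi DiD] fDi] := subDi i.
rewrite -natrM (formula_count d0 dim_le cD DC regC cDi DiD fDi).
rewrite 2!natrD natrM -/(missing_degree i).
have : d.+1%:R != 0 :> R by rewrite pnatr_eq0.
by move: (d.+1%:R) => N N0; field.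
Qed.

Lemma near_missing_degree_ge (B : {fset {fset V}}) : [set` B] `<=` C `\` D ->
  \forall i \near \oo, (#|` B|%:R : R) <= (missing_degree i)%:R / d.+1%:R.
Proof.
move=> BT; have := @near_facets V C D Di B limD.
move=> /(_ (fun t v tB vt => facet_missing d0 (BT t tB) vt)).
apply: filterS => i BDi; have [[cDi DiD] fDi] := subDi i.
rewrite ler_pdivlMr ?ltr0n// -natrM ler_nat mulnC.
apply: (sum_degree_ge d0 hC DC regC cDi DiD fDi) => //.
by move=> t tB; exact: dim_missing (BT t tB).
Qed.

(** The lower bound for the set of all missing simplices, valid eventually, meets the upper bound
    [sum_degree_le], valid for every i. *)
Lemma near_missing_degree_eq : finite_set (C `\` D) -> \forall i \near \oo,
  (missing_degree i)%:R / d.+1%:R = #|` fset_set (C `\` D)|%:R :> R.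
Proof.
move=> fT; have BT : [set` fset_set (C `\` D)] = C `\` D by exact: fset_setK.
have BT' : [set` fset_set (C `\` D)] `<=` C `\` D by rewrite BT.
apply: filterS (near_missing_degree_ge BT') => i ge.
have [[cDi DiD] fDi] := subDi i.
apply/eqP; rewrite eq_le ge andbT ler_pdivrMr ?ltr0n// -natrM ler_nat mulnC.
apply: (sum_degree_le d0 hC cDi fDi BT).
by move=> t tB; exact: dim_missing (BT' t tB).
Qed.

End Assembly.

Theorem theorem5p1 (R : realType) (V : choiceType) (d : nat)
    (C D : set {fset V})
    (hC : simplicial_complex C) (countableC : countable C)
    (dimC : has_dimension C d)
    (spanD : spanning_subcomplex d C D)
    (contrD : contractible R (realization R D)) :
  exists r : option nat,
    homotopy_equivalent_to_bouquet R (realization R C) d r /\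
    ((0 < d)%N ->
     forall (n : nat) (Di : nat -> set {fset V}),
       regular d n C ->
       (forall i, subcomplex (Di i) D /\ finite_set (Di i)) ->
       is_liminf D Di ->
       (((d.+1%:R^-1 *
           (n%:R * (beta d.-1 (Di i))%:R -
            (total_degree (generated (D `\` Di i))
               (F d.-1 (boundary D (Di i))))%:R)
          - (beta d (Di i))%:R)%:E : \bar R) @[i --> \oo]
        --> ereal_of_count R r)).
Proof.
have [fT|iT] := pselect (finite_set (C `\` D)).
  exists (Some #|` fset_set (C `\` D)|).
  split=> [|d0 n Di regC subDi limD]; first exact: homotopy_equivalent_finite.
  apply: cvg_near_cst.
  apply: filterS (near_missing_degree_eq R hC dimC spanD d0 regC subDi limD fT).
  by move=> i; rewrite (sequence_count R dimC spanD d0 regC subDi) => ->.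
exists None; split=> [|d0 n Di regC subDi limD].
  exact: (homotopy_equivalent_infinite hC dimC spanD contrD countableC iT).
apply/cvgeryP/cvgryPge => a.
(* Finitely many missing simplices, enough to exceed the prescribed bound a, already push the
   sequence above a. *)
have [B BT aB] := infinite_set_fset (Num.bound `|a|) iT.
apply: filterS (near_missing_degree_ge R hC dimC spanD d0 regC subDi limD BT).
move=> i; rewrite (sequence_count R dimC spanD d0 regC subDi).
apply: le_trans; apply: le_trans (ler_norm a) _.
apply: le_trans (ltW (archi_boundP (normr_ge0 a))) _.
by rewrite ler_nat.
Qed.
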